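(* Let $E/K$ be a finite Galois extension of fields with Galois group $(G,\cdot)$, let $L$ be an intermediate field of $E/K$ with corresponding subgroup $G'=\mathrm{Gal}(E/L)\subseteq G$, and let $X=G/G'$ be the left coset space, with $\bar x=xG'$ for $x\in G$. There are bijections between (1) binary operations $\star$ on $X$ such that $(G,\cdot,X,\star,\odot)$ is a skew bracoid, where $\odot$ denotes left translation of cosets, $g\odot\bar x=\overline{gx}$; (2) $G$-stable regular subgroups of $\mathrm{Perm}(X)$; (3) Hopf-Galois structures on $L/K$.
   Context: A (left) skew bracoid is a $5$-tuple $(G,\cdot,N,\star,\odot)$ such that $(G,\cdot)$ and $(N,\star)$ are groups and $\odot$ is a transitive action of $(G,\cdot)$ on the set $N$ such that $g\odot(\eta\star\mu)=(g\odot\eta)\star(g\odot e_N)^{-1}\star(g\odot\mu)$ for all $g\in G$ and $\eta,\mu\in N$, where $e_N$ is the identity of $N$ and inverses of elements of $N$ are taken in $(N,\star)$. $\mathrm{Perm}(X)$ is the group of permutations of $X$. Let $\lambda_\odot:G\to\mathrm{Perm}(X)$, $\lambda_\odot(g)[\bar x]=\overline{gx}$. A subgroup of $\mathrm{Perm}(X)$ is regular if it acts transitively and fixed-point freely (i.e. with trivial point stabilizers) on $X$. A subgroup $N$ of $\mathrm{Perm}(X)$ is $G$-stable if $\lambda_\odot(g)N\lambda_\odot(g)^{-1}=N$ for all $g\in G$. A Hopf-Galois structure on the finite extension $L/K$ consists of a (finite-dimensional) $K$-Hopf algebra $H$ and a $K$-linear action of $H$ on $L$ making $L$ an $H$-module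 algebra and such that the $K$-linear map $L\otimes_K H\to\mathrm{End}_K(L)$, $\ell\otimes h\mapsto(t\mapsto \ell\,h(t))$, is bijective. As usual, two Hopf-Galois structures $H,H_1$ on $L/K$ are regarded as the same if there is an isomorphism of $K$-Hopf algebras $H\to H_1$ compatible with the actions on $L$.
   Formalization: In (1) the operation ⋆ is additionally required to have the coset of 1 as its identity; without this the claim fails, e.g. for |X|=2 there are two such operations but only one regular subgroup of Perm(X). *)

(* Defs.v *)
From HB Require Import structures.
From mathcomp Require Import all_boot all_order all_algebra all_fingroup all_field.

Set Implicit Arguments.
Unset Strict Implicit.
Unset Printing Implicit Defensive.
Import GRing.Theory.
Local Open Scope ring_scope.

(* V (x) W for finite-dimensional spaces, realized as the linear maps from the
   dual of V to W; the pure tensor v (x) w is phi |-> phi(v) w.  Lemmas tlift_tens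
   and tens_ext below give its universal property. *)
Definition tensor (K : fieldType) (V W : vectType K) : vectType K :=
  'Hom('Hom(V, K^o), W).

Definition tens (K : fieldType) (V W : vectType K) (v : V) (w : W) :
    tensor V W :=
  linfun (fun phi : 'Hom(V, K^o) => (phi v : K) *: w).

(* For bilinear b, tlift b is the linear map with tlift b (tens v w) = b v w.
   In Sweedler notation, tlift b (comul h) is the sum of the b h_(1) h_(2). *)
Definition tlift (K : fieldType) (V W U : vectType K) (b : V -> W -> U)
    (u : tensor V W) : U :=
  \sum_(i < \dim {:V})
    b (vbasis {:V})`_i (u (linfun (coord (vbasis {:V}) i : V -> K^o))).

Section LinearFun.
Variables (K : fieldType) (V W : vectType K) (f : V -> W) (lin_f : linear f).

Lemma linfunE : linfun f =1 f.
Proof.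
pose M := GRing.isSemilinear.Build K V W _ f (GRing.semilinear_linear lin_f).
pose F : {linear V -> W} := HB.pack_for {linear V -> W} f M.
exact: (lfunE F).
Qed.

End LinearFun.

Section TensorTheory.
Variables (K : fieldType) (V W : vectType K).

Lemma tensE (v : V) (w : W) (phi : 'Hom(V, K^o)) :
  tens v w phi = (phi v : K) *: w.
Proof.
apply: linfunE => a f g.
by rewrite add_lfunE scale_lfunE scalerDl scalerA.
Qed.

Lemma tens_linearl (w : W) : linear (fun v : V => tens v w).
Proof.
move=> a v v'; apply/lfunP => phi.
by rewrite add_lfunE scale_lfunE !tensE linearP scalerDl scalerA.
Qed.

Lemma tens_linearr (v : V) : linear (fun w : W => tens v w).
Proof.
move=> a w w'; apply/lfunP => phi.
by rewrite add_lfunE scale_lfunE !tensE scalerDr !scalerA mulrC.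
Qed.

Lemma tensor_expand (u : tensor V W) : u = tlift (@tens K V W) u.
Proof.
apply/lfunP => phi; rewrite sum_lfunE.
have -> : phi = \sum_(i < \dim {:V})
    (phi (vbasis {:V})`_i : K) *: linfun (coord (vbasis {:V}) i : V -> K^o).
  apply/lfunP => v; rewrite sum_lfunE {1}(coord_vbasis (memvf v)) linear_sum.
  apply: eq_bigr => i _; rewrite scale_lfunE linearZ /= lfunE /=.
  exact: mulrC.
rewrite linear_sum; apply: eq_bigr => i _; rewrite linearZ tensE /=.
congr (_ *: _); rewrite sum_lfunE (bigD1 i) //= big1 ?addr0.
  rewrite scale_lfunE lfunE /= coord_free ?(basis_free (vbasisP _)) //.
  by rewrite eqxx; apply/esym/mulr1.
move=> j ji; rewrite scale_lfunE lfunE /= coord_free ?(basis_free (vbasisP _)) //.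
case: eqP => [eij|_]; last exact: mulr0.
by rewrite eij eqxx in ji.
Qed.

Lemma tlift_linear (U : vectType K) (b : V -> W -> U) :
  (forall v, linear (b v)) -> linear (tlift b).
Proof.
move=> br a u u'; rewrite /tlift scaler_sumr -big_split.
by apply: eq_bigr => i _; rewrite add_lfunE scale_lfunE br.
Qed.

Lemma tlift_tens (U : vectType K) (b : V -> W -> U) (v : V) (w : W) :
  (forall v, linear (b v)) -> (forall w, linear (b^~ w)) ->
  tlift b (tens v w) = b v w.
Proof.
move=> br bl.
rewrite -[RHS](linfunE (bl w)) {2}(coord_vbasis (memvf v)) linear_sum.
apply: eq_bigr => i _; rewrite tensE lfunE linearZ /= (linfunE (bl w)).
rewrite -(linfunE (br (vbasis {:V})`_i)) linearZ /=.
by rewrite (linfunE (br (vbasis {:V})`_i)).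
Qed.

Lemma tens_ext (U : vectType K) (f g : {linear tensor V W -> U}) :
  (forall v w, f (tens v w) = g (tens v w)) -> f =1 g.
Proof.
move=> fg u; rewrite (tensor_expand u) /tlift !linear_sum.
by apply: eq_bigr => i _; apply: fg.
Qed.

End TensorTheory.

Definition tensor_mul (K : fieldType) (A B : falgType K) (u v : tensor A B) :
    tensor A B :=
  tlift (fun a b => tlift (fun a' b' => tens (a * a') (b * b')) v) u.

Record hopfAlgebra (K : fieldType) := HopfAlgebra {
  hopf_sort :> falgType K;
  comul : 'Hom(hopf_sort, tensor hopf_sort hopf_sort);
  counit : 'Hom(hopf_sort, K^o);
  antipode : 'End(hopf_sort);
  (* both sides lie in H (x) (H (x) H) *)
  comulA : forall h,
    tlift (fun a b => tlift (fun c d => tens c (tens d b)) (comul a)) (comul h)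
    = tlift (fun a b => tens a (comul b)) (comul h);
  counitl : forall h, tlift (fun a b => (counit a : K) *: b) (comul h) = h;
  counitr : forall h, tlift (fun a b => (counit b : K) *: a) (comul h) = h;
  comul1 : comul 1 = tens 1 1;
  comulM : forall h k, comul (h * k) = tensor_mul (comul h) (comul k);
  counit1 : counit 1 = 1;
  counitM : forall h k, counit (h * k) = counit h * counit k;
  antipodel : forall h,
    tlift (fun a b => antipode a * b) (comul h) = (counit h : K)%:A;
  antipoder : forall h,
    tlift (fun a b => a * antipode b) (comul h) = (counit h : K)%:A
}.

Record hopfGalois (K : fieldType) (L : fieldExtType K) := HopfGalois {
  hg_alg :> hopfAlgebra K;
  hg_act : 'Hom(hg_alg, 'End(L));
  hg_act1 : hg_act 1 = \1%VF;
  hg_actM : forall h k, hg_act (h * k) = (hg_act h \o hg_act k)%VF;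
  hg_act_unit : forall h, hg_act h 1 = (counit hg_alg h : K)%:A;
  hg_act_mul : forall h s t,
    hg_act h (s * t) =
      tlift (fun a b => hg_act a s * hg_act b t) (comul hg_alg h);
  (* amull l \o hg_act h is t |-> l * h(t) *)
  hg_bij : bijective
    (tlift (fun (l : L) (h : hg_alg) => (amull l \o hg_act h)%VF))
}.

Definition hg_iso (K : fieldType) (L : fieldExtType K)
    (H H1 : hopfGalois L) : Prop :=
  exists F : 'Hom(H, H1),
    [/\ bijective F,
        F 1 = 1 /\ (forall h k, F (h * k) = F h * F k),
        (forall h, comul H1 (F h) = tlift (fun a b => tens (F a) (F b)) (comul H h))
          /\ (forall h, counit H1 (F h) = counit H h),
        forall h, antipode H1 (F h) = F (antipode H h)
      & forall h, hg_act H1 (F h) = hg_act H h].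

(* The isomorphism classes of Hopf-Galois structures: the quotient by hg_iso. *)
Definition hopf_galois_structures (K : fieldType) (L : fieldExtType K) :=
  {C : hopfGalois L -> Prop | exists H, C = hg_iso H}.

Definition group_axioms (T : Type) (op : T -> T -> T) (e : T) (inv : T -> T) :=
  [/\ associative op, left_id e op, right_id e op,
      left_inverse e inv op & right_inverse e inv op].

Definition skew_bracoid (G : Type) (dot : G -> G -> G)
    (N : Type) (star : N -> N -> N) (odot : G -> N -> N) : Prop :=
  exists (eG : G) (invG : G -> G) (eN : N) (invN : N -> N),
    [/\ group_axioms dot eG invG,
        group_axioms star eN invN,
        (forall x, odot eG x = x)
          /\ (forall g h x, odot (dot g h) x = odot g (odot h x)),
        (forall x y, exists g, odot g x = y)
      & (forall g x y,
          odot g (star x y) =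
            star (star (odot g x) (invN (odot g eN))) (odot g y))].

Section CosetSpace.
Variables (K : fieldType) (E : splittingFieldType K) (L : {subfield E}).

(* 'Gal({:E} / 1) is the whole type gal_of {:E}: see galois_group_setT. *)
Notation G := (gal_of {:E}).

Lemma galois_group_setT : 'Gal({:E} / 1%AS)%g = [set: G].
Proof.
apply/setP=> x; rewrite !inE gal_kAut ?sub1v //.
rewrite kAutE; apply/andP; split; last exact: subvf.
by apply/kHomP; split=> [a b _ _|a /vlineP[k ->]];
  rewrite ?rmorphM // linearZ /= rmorph1.
Qed.

(* The library's product of G is composition in the reverse order:
   (g * h)%g t = h (g t).  The group law of the Galois group is composition. *)
Definition gal_comp (g h : G) : G := (h * g)%g.

Lemma gal_compE (g h : G) (t : E) : gal_comp g h t = g (h t).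
Proof. by rewrite /gal_comp galM ?memvf. Qed.

Definition gal_lcoset (x : G) : {set G} :=
  [set gal_comp x h | h in 'Gal({:E} / L)%g].

Definition coset_space : finType :=
  {C : {set G} | C \in [set gal_lcoset x | x : G]}.

Lemma gal_lcoset_in (x : G) : gal_lcoset x \in [set gal_lcoset x | x : G].
Proof. exact: imset_f. Qed.

Definition cbar (x : G) : coset_space := exist _ (gal_lcoset x) (gal_lcoset_in x).

Lemma cbar_eqP (x y : G) :
  reflect (cbar x = cbar y) (gal_comp (x^-1)%g y \in 'Gal({:E} / L)%g).
Proof.
have cosE z : gal_lcoset z = ('Gal({:E} / L) :* z)%g.
  by rewrite -rcosetE.
have -> : (gal_comp x^-1 y \in 'Gal({:E} / L))%g = (cbar x == cbar y).
  rewrite -val_eqE /= !cosE; apply/idP/eqP => [xy | eqC].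
    by apply/esym/rcoset_eqP; rewrite mem_rcoset.
  by rewrite /gal_comp -mem_rcoset eqC rcoset_refl.
exact: eqP.
Qed.

Lemma translate_in (g : G) (C : coset_space) :
  [set gal_comp g x | x in val C] \in [set gal_lcoset x | x : G].
Proof.
case: C => C /= /imsetP[x _ ->]; apply/imsetP; exists (gal_comp g x) => //.
rewrite /gal_lcoset -imset_comp; apply: eq_imset => h /=.
by rewrite /gal_comp mulgA.
Qed.

Definition coset_translate (g : G) (C : coset_space) : coset_space :=
  exist _ [set gal_comp g x | x in val C] (translate_in g C).

Lemma coset_translate_cbar (g x : G) :
  coset_translate g (cbar x) = cbar (gal_comp g x).
Proof.
apply: val_inj; rewrite /= /gal_lcoset -imset_comp; apply: eq_imset => h /=.
by rewrite /gal_comp mulgA.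
Qed.

Lemma coset_translate_inj (g : G) : injective (coset_translate g).
Proof.
move=> C D /(congr1 val) /= eqCD; apply: val_inj.
by apply: (imset_inj (mulIg g)).
Qed.

Definition lambda_odot (g : G) : {perm coset_space} :=
  perm (@coset_translate_inj g).

(* X is based at the coset of 1, which is required to be the identity of star.
   The bracoid axioms alone do not force this: transporting a star along the
   regular group of its left translations gives one bracoid operation with the
   same group for each choice of the identity in X. *)
Definition bracoid_operations :=
  {star : coset_space -> coset_space -> coset_space |
     skew_bracoid gal_comp star coset_translate
     /\ left_id (cbar 1%g) star /\ right_id (cbar 1%g) star}.

Definition regular (N : {group {perm coset_space}}) : Prop :=
  [transitive N, on [set: coset_space] | 'P]
  /\ (forall x, ('C_N[x | 'P])%g = 1%g).

(* The library's product of permutations is also in reverse order, so that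
   N :^ lambda_odot g is the set of the
   lambda_odot g \o n \o (lambda_odot g)^-1 for n in N. *)
Definition G_stable (N : {group {perm coset_space}}) : Prop :=
  forall g, (N :^ lambda_odot g)%g = N :> {set {perm coset_space}}.

Definition stable_regular_subgroups :=
  {N : {group {perm coset_space}} | G_stable N /\ regular N}.

End CosetSpace.

(* Main.v *)
Require Import Defs.
From HB Require Import structures.
From mathcomp Require Import all_boot all_order all_algebra all_fingroup all_field.
From Stdlib Require Import ClassicalEpsilon FunctionalExtensionality.
From Stdlib Require Import PropExtensionality ProofIrrelevance.

Set Implicit Arguments.
Unset Strict Implicit.
Unset Printing Implicit Defensive.
Import GRing.Theory.
Local Open Scope ring_scope.

(* A bracoid operation star on X is sent to the group of its left translations;
   back, a stable regular N gives x * y := n(y) for the n in N with n(e) = x.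

   Hopf-Galois structures enter by reading X as the set of K-embeddings of L in
   E, an E-basis of Hom_K(L, E).  A star yields the Hopf algebra E[X]^G of
   G-equivariant functions on X, acting by h(t) = sum_y h_y y(t); by
   nondegeneracy of the trace of E/K it spans E[X] over E.  Conversely, a
   Hopf-Galois structure H makes E (x) H isomorphic to Hom_K(L, E), so every
   embedding y is the action of a unique u_y in E (x) H.  Comparing
   y(st) = y(s) y(t) with the action of comul shows that u_y is grouplike, so
   the u_y form a group with underlying set X, which gives star.  Finally H is
   determined up to isomorphism by its image in End_K(L): H (x) H embeds in the
   bilinear maps L x L -> L, which determines comul, hence the antipode. *)

(** * Families of linear forms with values in an extension field *)

(** Extension of scalars to E is never formed. An element of E (x) V is a tuple of coordinates in
    the fixed K-basis of V, and an E-linear form on it is given by its restriction, a K-linear map V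
    -> E. For a family of such forms, [E_independent] is linear independence over E and
    [E_separating] says that they span the dual; together they make the coefficient matrix square
    and invertible. The obstacle is the passage from K to E: a family without common zero in V may
    have one in E (x) V. Galois descent excludes this for families stable under G; for a given
    Hopf-Galois structure the bijectivity of its canonical map plays that part. Identities in H and
    its tensor powers are then checked on coefficients, where H looks like a group algebra and
    comultiplication is diagonal. The bracoid law enters through [star_conj]: it makes this twisted
    action of G multiplicative, so that convolution preserves equivariant functions. *)

Section LinearBasics.
Variables (K : fieldType) (V W : vectType K) (f : V -> W) (lin_f : linear f).

Lemma linear_fun0 : f 0 = 0.
Proof. by rewrite -(linfunE lin_f) linear0. Qed.

Lemma linear_funD u v : f (u + v) = f u + f v.
Proof. by rewrite -!(linfunE lin_f) linearD. Qed.

Lemma linear_funZ a v : f (a *: v) = a *: f v.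
Proof. by rewrite -!(linfunE lin_f) linearZ. Qed.

Lemma linear_fun_sum (I : Type) (r : seq I) (P : pred I) (v : I -> V) :
  f (\sum_(i <- r | P i) v i) = \sum_(i <- r | P i) f (v i).
Proof.
rewrite -(linfunE lin_f) linear_sum.
by apply: eq_bigr => i _; exact: linfunE.
Qed.

Lemma linear_fun_coord v :
  f v = \sum_k coord (vbasis {:V}) k v *: f (vbasis {:V})`_k.
Proof.
rewrite {1}(coord_vbasis (memvf v)) linear_fun_sum.
by apply: eq_bigr => k _; rewrite linear_funZ.
Qed.

End LinearBasics.

Lemma linear_sum_fun (K : fieldType) (V W : vectType K) (I : Type) (r : seq I)
    (f : I -> V -> W) :
  (forall i, linear (f i)) -> linear (fun v => \sum_(i <- r) f i v).
Proof.
move=> lin a u v; rewrite scaler_sumr -big_split.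
by apply: eq_bigr => i _; rewrite lin.
Qed.

Lemma linear_mull_fun (K : fieldType) (V : vectType K) (E : fieldExtType K)
    (a : E) (f : V -> E) :
  linear f -> linear (fun v => a * f v).
Proof. by move=> lin k u v; rewrite lin mulrDr scalerAr. Qed.

Lemma linear_mulr_fun (K : fieldType) (V : vectType K) (E : fieldExtType K)
    (a : E) (f : V -> E) :
  linear f -> linear (fun v => f v * a).
Proof. by move=> lin k u v; rewrite lin mulrDl scalerAl. Qed.

Lemma sum_delta (R : pzSemiRingType) (I : finType) (i0 : I) (F : I -> R) :
  \sum_i (i0 == i)%:R * F i = F i0.
Proof.
rewrite (bigD1 i0) //= eqxx mul1r big1 ?addr0 // => i /negPf.
by rewrite eq_sym => ->; rewrite mul0r.
Qed.

Section Families.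
Variables (K : fieldType) (E : fieldExtType K).

Definition E_independent (V : Type) (I : finType) (f : I -> V -> E) :=
  forall a : I -> E,
    (forall v, \sum_i a i * f i v = 0) -> forall i, a i = 0.

Definition separating (V : vectType K) (I : Type) (f : I -> V -> E) :=
  forall v, (forall i, f i v = 0) -> v = 0.

(* The K-basis of V stays linearly independent after extension of scalars to E
   and evaluation by the family. *)
Definition E_separating (V : vectType K) (I : Type) (f : I -> V -> E) :=
  forall a : 'I_(\dim {:V}) -> E,
    (forall i, \sum_k a k * f i (vbasis {:V})`_k = 0) -> forall k, a k = 0.

(* D i lists the coordinates of the element u_i of E (x) V with
   f_j(u_i) = [i == j]; phi is recovered from its values at the u_i. *)
Definition dual_family (V : vectType K) (I : finType) (f : I -> V -> E)
    (D : I -> 'I_(\dim {:V}) -> E) :=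
  (forall i j, \sum_k D i k * f j (vbasis {:V})`_k = (i == j)%:R) /\
  (forall phi : V -> E, linear phi -> forall v,
     phi v = \sum_i (\sum_k D i k * phi (vbasis {:V})`_k) * f i v).

Lemma E_independent_eq (V : Type) (I : finType) (f : I -> V -> E)
    (a b : I -> E) :
  E_independent f -> (forall v, \sum_i a i * f i v = \sum_i b i * f i v) ->
  a =1 b.
Proof.
move=> indep eqab i; apply/eqP; rewrite -subr_eq0; apply/eqP.
apply: (indep (fun i => a i - b i)) => v.
under eq_bigr do rewrite mulrBl.
by rewrite sumrB eqab subrr.
Qed.

(** This turns equations between points of X into equations between functions, which is how
    identities for [star] are obtained later. *)
Lemma E_independent_inj (V : Type) (I : finType) (f : I -> V -> E) i j :
  E_independent f -> f i =1 f j -> i = j.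
Proof.
move=> indep fij.
have := @E_independent_eq _ _ _
  (fun k => (i == k)%:R) (fun k => (j == k)%:R) indep.
have eqf v : \sum_k (i == k)%:R * f k v = \sum_k (j == k)%:R * f k v.
  by rewrite !sum_delta.
move/(_ eqf i); rewrite eqxx; case: (eqVneq j i) => // _ /eqP.
by rewrite oner_eq0.
Qed.

Lemma E_separating_separating (V : vectType K) (I : Type) (f : I -> V -> E) :
  (forall i, linear (f i)) -> E_separating f -> separating f.
Proof.
move=> lin_f sep v fv0.
have c0 k : (coord (vbasis {:V}) k v)%:A = 0 :> E.
  apply: (sep (fun k => (coord (vbasis {:V}) k v)%:A)) => i.
  rewrite -[RHS](fv0 i) (linear_fun_coord (lin_f i)).
  by apply: eq_bigr => k' _; rewrite mulr_algl.
rewrite (coord_vbasis (memvf v)) big1 // => k _.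
move/eqP: (c0 k); rewrite scaler_eq0 oner_eq0 orbF => /eqP->.
by rewrite scale0r.
Qed.

Section Matrix.
Variables (V : vectType K) (I : finType) (f : I -> V -> E).
Hypothesis lin_f : forall i, linear (f i).

Let M : 'M[E]_(#|I|, \dim {:V}) :=
  \matrix_(i, k) f (enum_val i) (vbasis {:V})`_k.

Lemma sum_enum_val (F : I -> E) : \sum_(i < #|I|) F (enum_val i) = \sum_i F i.
Proof. by rewrite [RHS](reindex _ (onW_bij _ (enum_val_bij I))). Qed.

Let row_free_M : E_independent f -> row_free M.
Proof.
move=> indep; apply: inj_row_free => a aM0; apply/rowP=> i; rewrite mxE.
rewrite -(enum_valK i).
apply: (indep (fun j => a ord0 (enum_rank j))) => v.
rewrite -sum_enum_val; under eq_bigr => j _.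
  rewrite enum_valK (linear_fun_coord (lin_f _)) mulr_sumr.
  under eq_bigr => k _ do rewrite -scalerAr.
over.
rewrite exchange_big big1 // => k _ /=; rewrite -scaler_sumr.
move/rowP/(_ k): aM0; rewrite !mxE => aM0.
rewrite (eq_bigr (fun j => a ord0 j * M j k)) ?aM0 ?scaler0 // => j _.
by rewrite mxE.
Qed.

Lemma card_E_independent :
  E_independent f -> E_separating f -> #|I| = \dim {:V}.
Proof.
move=> indep sep; apply/eqP; rewrite eqn_leq.
have /eqP rkM := row_free_M indep; rewrite -{1}rkM rank_leq_col /=.
suff /eqP rkMT : row_free M^T by rewrite -{1}rkMT rank_leq_col.
apply: inj_row_free => a aM0; apply/rowP=> k; rewrite mxE.
apply: (sep (fun k => a ord0 k)) => i.
move/rowP/(_ (enum_rank i)): aM0; rewrite !mxE => aM0.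
by rewrite -[RHS]aM0; apply: eq_bigr => j _; rewrite !mxE enum_rankK.
Qed.

(** The matrix M is square with independent rows. Its right inverse B supplies the coordinates [D];
    its left inverse C expands an arbitrary [phi] in the family. *)
Lemma dual_family_exists :
  E_independent f -> #|I| = \dim {:V} -> exists D, dual_family f D.
Proof.
move=> indep card; have freeM := row_free_M indep.
have /row_freeP[B MB] := freeM.
have /row_fullP[C CM] : row_full M.
  by rewrite /row_full (eqP freeM) card.
exists (fun i k => B k (enum_rank i)).
have D1 i j : \sum_k B k (enum_rank i) * f j (vbasis {:V})`_k = (i == j)%:R.
  move/matrixP/(_ (enum_rank j) (enum_rank i)): MB; rewrite !mxE eq_sym.
  rewrite (inj_eq (can_inj (@enum_rankK _))) => <-; apply: eq_bigr => k _.
  by rewrite !mxE enum_rankK mulrC.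
split=> // phi lin v.
pose r : 'rV[E]_(\dim {:V}) := \row_k phi (vbasis {:V})`_k.
pose p i := (r *m C) ord0 (enum_rank i).
have phiE w : phi w = \sum_i p i * f i w.
  rewrite (linear_fun_coord lin).
  under [RHS]eq_bigr => i _.
    rewrite (linear_fun_coord (lin_f _)) mulr_sumr.
    under eq_bigr => k _ do rewrite -scalerAr.
  over.
  rewrite exchange_big; apply: eq_bigr => k _ /=; rewrite -scaler_sumr.
  congr (_ *: _); have /rowP/(_ k) := mulmx1 r.
  rewrite -CM mulmxA !mxE => <-; rewrite -sum_enum_val.
  by apply: eq_bigr => i _; rewrite /p enum_valK; congr (_ * _); rewrite mxE.
rewrite phiE; apply: eq_bigr => i _; congr (_ * _).
under eq_bigr => k _ do rewrite phiE mulr_sumr.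
rewrite exchange_big /=.
under eq_bigr => j _.
  under eq_bigr => k _ do rewrite mulrCA.
  rewrite -mulr_sumr D1 mulrC.
over.
by rewrite sum_delta.
Qed.

End Matrix.

Section Tlift.
Variables V W : vectType K.

Lemma eq_tlift (U : vectType K) (B B' : V -> W -> U) u :
  (forall a b, B a b = B' a b) -> tlift B u = tlift B' u.
Proof. by move=> eqB; apply: eq_bigr => i _; apply: eqB. Qed.

Lemma tlift_comp (U U' : vectType K) (j : U -> U') (B : V -> W -> U) u :
  linear j -> j (tlift B u) = tlift (fun a b => j (B a b)) u.
Proof. by move=> lin_j; rewrite /tlift linear_fun_sum. Qed.

Lemma tlift_sum (U : vectType K) (J : Type) (r : seq J) (P : pred J)
    (B : J -> V -> W -> U) u :
  tlift (fun a b => \sum_(j <- r | P j) B j a b) u =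
  \sum_(j <- r | P j) tlift (B j) u.
Proof. by rewrite /tlift exchange_big. Qed.

Lemma tlift_mull (k : E) (B : V -> W -> E) u :
  tlift (fun a b => k * B a b) u = k * tlift B u.
Proof. by rewrite /tlift mulr_sumr. Qed.

Lemma tlift_linear_mul (f : V -> E) (p : W -> E) :
  linear p -> linear (tlift (fun v w => f v * p w)).
Proof. by move=> lin; apply: tlift_linear => v; apply: linear_mull_fun. Qed.

(** The hypotheses are asymmetric because, for fixed j, the values of [p j] on the second components
    are coefficients in E of a relation on [f]. Once these vanish, plain separation by [p]
    finishes. *)
Lemma tensor_separating (I J : Type) (f : I -> V -> E) (p : J -> W -> E) :
  (forall j, linear (p j)) -> E_separating f -> separating p ->
  separating (fun ij : I * J => tlift (fun v w => f ij.1 v * p ij.2 w)).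
Proof.
move=> lin_p sep_f sep_p u u0; rewrite (tensor_expand u) /tlift big1 // => i _.
suff -> : u (linfun (coord (vbasis {:V}) i : V -> K^o)) = 0.
  by apply: linear_fun0; apply: tens_linearr.
apply: sep_p => j.
apply: (sep_f (fun k => p j (u (linfun (coord (vbasis {:V}) k : V -> K^o))))) => x.
by rewrite -[RHS](u0 (x, j)); apply: eq_bigr => k _; rewrite mulrC.
Qed.

End Tlift.

Lemma separating_eq (V : vectType K) (I : Type) (f : I -> V -> E) :
  (forall i, linear (f i)) -> separating f ->
  forall u v, (forall i, f i u = f i v) -> u = v.
Proof.
move=> lin sep u v eqf; apply/eqP; rewrite -subr_eq0; apply/eqP/sep => i.
by rewrite -scaleN1r addrC lin eqf scaleN1r addNr.
Qed.

End Families.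

Lemma bijective_lfun (K : fieldType) (V W : vectType K) (f : 'Hom(V, W)) :
  \dim {:V} = \dim {:W} -> (forall v, f v = 0 -> v = 0) -> bijective f.
Proof.
move=> dimVW inj; have ker0 : lker f == 0%VS.
  apply/eqP/vspaceP => v; rewrite memv_ker memv0.
  by apply/eqP/eqP=> [/inj //|->]; rewrite linear0.
have img : limg f = fullv.
  apply/eqP; rewrite eqEdim subvf -dimVW limg_dim_eq ?leqnn //.
  by rewrite (eqP ker0) capv0.
exists f^-1%VF; first exact: lker0_lfunK.
by move=> w; apply: limg_lfunVK; rewrite img memvf.
Qed.

Lemma bijective_linear (K : fieldType) (V W : vectType K) (f : V -> W) :
  linear f -> \dim {:V} = \dim {:W} -> (forall v, f v = 0 -> v = 0) ->
  bijective f.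
Proof.
move=> lin dimVW inj; apply: (@eq_bij _ _ (linfun f)); last exact: linfunE.
by apply: bijective_lfun => // v; rewrite linfunE //; apply: inj.
Qed.

Lemma bijective_dim (K : fieldType) (V W : vectType K) (f : V -> W) :
  linear f -> bijective f -> \dim {:V} = \dim {:W}.
Proof.
move=> lin [g fK gK]; rewrite -(@limg_dim_eq _ _ _ (linfun f) fullv).
  congr (\dim _); apply/vspaceP => w; rewrite memvf.
  by rewrite -(gK w) -(linfunE lin) memv_img ?memvf.
apply/vspaceP => v; rewrite capfv memv_ker memv0 linfunE //.
apply/eqP/eqP => [fv0|->]; last exact: linear_fun0.
by apply: (can_inj fK); rewrite fv0 linear_fun0.
Qed.

Lemma dim_tensor (K : fieldType) (V W : vectType K) :
  \dim {:tensor V W} = (\dim {:V} * \dim {:W})%N.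
Proof. by rewrite !dimvf /tensor /dim /= /dim /= muln1. Qed.

Lemma dim_End (K : fieldType) (V : vectType K) :
  \dim {:'End(V)} = (\dim {:V} * \dim {:V})%N.
Proof. by rewrite !dimvf. Qed.

(** * The embeddings of L in E *)

Section Galois.
Variables (K : fieldType) (E : splittingFieldType K).
Hypothesis galE : galois 1%AS {:E}.

Notation G := (gal_of {:E}).

Definition gal_trace (a : E) := \sum_(g : G) g a.

Lemma gal_invariant_scalar (a : E) :
  (forall g : G, g a = a) -> exists k, a = k%:A.
Proof.
move=> fix_a; apply/vlineP.
have /galois_fixedField := galE; rewrite galois_group_setT => fixE.
have : a \in fixedField [set: G] by apply/fixedFieldP; rewrite ?memvf.
by rewrite fixE.
Qed.

Lemma gal_comp_trace (g : G) a : g (gal_trace a) = gal_trace a.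
Proof.
rewrite rmorph_sum [RHS](reindex_inj (mulIg g)).
by apply: eq_bigr => h _; rewrite galM ?memvf.
Qed.

Lemma gal_trace_scalar a : exists k : K, gal_trace a = k%:A.
Proof. by apply: gal_invariant_scalar => g; apply: gal_comp_trace. Qed.

(** The traces of all s * a form a relation between the automorphisms, with coefficients g a.
    Dedekind independence makes these zero, in particular at g = 1. *)
Lemma gal_trace_nondegenerate a : (forall s, gal_trace (s * a) = 0) -> a = 0.
Proof.
move=> tr0; have := @gal_independent _ _ {:E}%AS predT (fun g : G => g a).
move/(_ _ 1%g isT); rewrite gal_id; apply=> s _.
rewrite -[RHS](tr0 s); apply: eq_bigr => g _.
by rewrite rmorphM mulrC.
Qed.

(** Galois descent. Multiply a relation by s, apply g and sum over G: as the family is stable under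
    G, the traces of s * a k again form a relation, now with coefficients in K. Separation and
    freeness of the basis kill these traces for every s, and the trace form is nondegenerate. *)
Lemma gal_E_separating (V : vectType K) (I : Type) (f : I -> V -> E) :
  (forall i, linear (f i)) -> separating f ->
  (forall (g : G) i, exists j, forall v, g (f i v) = f j v) ->
  E_separating f.
Proof.
move=> lin sep closed a a0 k; apply: gal_trace_nondegenerate => s.
have tr_a0 i : \sum_k gal_trace (s * a k) * f i (vbasis {:V})`_k = 0.
  under eq_bigr => j _ do rewrite mulr_suml.
  rewrite exchange_big big1 // => g _ /=.
  have [j fj] := closed (g^-1)%g i.
  have fi v : f i v = g (f j v) by rewrite -fj -galM ?memvf // mulVg gal_id.
  have := congr1 (fun z => g (s * z)) (a0 j).
  rewrite /= mulr0 rmorph0 => ga0; rewrite -[RHS]ga0 mulr_sumr rmorph_sum.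
  by apply: eq_bigr => k' _; rewrite fi mulrA [RHS]rmorphM.
have [r r_tr] := fin_all_exists (fun k => gal_trace_scalar (s * a k)).
have v0 : \sum_k r k *: (vbasis {:V})`_k = 0.
  apply: sep => i; rewrite -[RHS](tr_a0 i) linear_fun_sum //.
  by apply: eq_bigr => k' _; rewrite linear_funZ // r_tr mulr_algl.
rewrite r_tr; have /freeP/(_ r v0 k) -> := basis_free (vbasisP {:V}).
by rewrite scale0r.
Qed.

Variable L : {subfield E}.
Notation X := (coset_space L).
Notation LK := (subvs_of L).

(** The representative does not matter, since Gal(E/L) fixes L pointwise. *)
Definition emb (C : X) (t : LK) : E := repr (val C) (vsval t).

Lemma coset_spaceP (C : X) : exists x, C = cbar L x.
Proof.
by case: C => C Cin; case/imsetP: (Cin) => x _ Cx; exists x; apply: val_inj.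
Qed.

Lemma emb_cbar x t : emb (cbar L x) t = x (vsval t).
Proof.
rewrite /emb; have : repr (val (cbar L x)) \in val (cbar L x).
  by apply: (mem_repr (gal_comp x 1%g)); apply: imset_f; apply: group1.
case/imsetP=> h hL ->; rewrite gal_compE; congr (x _).
by rewrite (fixed_gal _ hL) ?subvf ?subvsP.
Qed.

Lemma emb_base t : emb (cbar L 1%g) t = vsval t.
Proof. by rewrite emb_cbar gal_id. Qed.

Lemma emb_translate g C t : emb (coset_translate g C) t = g (emb C t).
Proof.
by have [x ->] := coset_spaceP C; rewrite coset_translate_cbar !emb_cbar gal_compE.
Qed.

Lemma emb_linear C : linear (emb C).
Proof. by move=> a s t; rewrite /emb !linearP. Qed.

Lemma embM C s t : emb C (s * t) = emb C s * emb C t.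
Proof. by rewrite /emb rmorphM. Qed.

Lemma emb1 C : emb C 1 = 1.
Proof. by rewrite /emb !rmorph1. Qed.

Lemma coset_translate1 (C : X) : coset_translate 1%g C = C.
Proof.
by have [x ->] := coset_spaceP C; rewrite coset_translate_cbar /gal_comp mulg1.
Qed.

Lemma coset_translateM (g h : G) (C : X) :
  coset_translate (gal_comp g h) C = coset_translate g (coset_translate h C).
Proof.
by have [x ->] := coset_spaceP C; rewrite !coset_translate_cbar /gal_comp mulgA.
Qed.

Lemma coset_translateVK (g : G) (C : X) :
  coset_translate (g^-1)%g (coset_translate g C) = C.
Proof. by rewrite -coset_translateM /gal_comp mulgV coset_translate1. Qed.

Lemma coset_translateKV (g : G) (C : X) :
  coset_translate g (coset_translate (g^-1)%g C) = C.
Proof. by rewrite -coset_translateM /gal_comp mulVg coset_translate1. Qed.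

Lemma coset_translate_trans (C D : X) : exists g : G, coset_translate g C = D.
Proof.
have [x ->] := coset_spaceP C; have [y ->] := coset_spaceP D.
by exists (gal_comp y x^-1%g); rewrite coset_translate_cbar /gal_comp mulKVg.
Qed.

Lemma coset_translate_base h : h \in 'Gal({:E} / L)%g ->
  coset_translate h (cbar L 1%g) = cbar L 1%g.
Proof.
move=> hL; rewrite coset_translate_cbar; apply/cbar_eqP.
by rewrite /gal_comp !mul1g groupV.
Qed.

Lemma gal_invariant_subfield a :
  (forall h : G, h \in 'Gal({:E} / L)%g -> h a = a) -> a \in L.
Proof.
move=> fix_a; have /galois_fixedField <- : galois L {:E}.
  by apply: galoisS galE; rewrite sub1v subvf.
by apply/fixedFieldP; rewrite ?memvf.
Qed.

Lemma emb_independent : E_independent emb.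
Proof.
move=> a a0 C; have [x ->] := coset_spaceP C.
apply: (@gal_independent _ _ {:E}%AS predT (fun y : G => a (cbar L y)) _ x isT) => s _.
(* The trace of s from E to L. Each embedding C sends it to the sum of y s over the automorphisms y
   in the coset C, so the relation on X lifts to one on G, where Dedekind independence applies. *)
pose t := \sum_(h in 'Gal({:E} / L)%g) h s.
have tL : t \in L.
  apply: gal_invariant_subfield => g gL; rewrite rmorph_sum.
  rewrite /t [RHS](reindex_inj (mulIg g)); apply: eq_big => [h|h _].
    by rewrite groupMr.
  by rewrite galM ?memvf.
have emb_t C' : emb C' (vsproj L t) = \sum_(y : G | cbar L y == C') y s.
  have [z ->] := coset_spaceP C'; rewrite emb_cbar vsprojK // rmorph_sum.
  transitivity (\sum_(y in gal_lcoset L z) y s).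
    rewrite [RHS]big_imset /=; last by move=> h h' _ _; apply: (mulIg z).
    by apply: eq_bigr => h _; rewrite gal_compE.
  apply: eq_bigl => y; apply/imsetP/eqP => [[h hL ->]|/esym/cbar_eqP zy].
    by apply/esym/cbar_eqP; rewrite /gal_comp mulgK.
  by exists (gal_comp z^-1 y)%g => //; rewrite /gal_comp mulgKV.
have := a0 (vsproj L t); under eq_bigr => C' _ do rewrite emb_t mulr_sumr.
rewrite (partition_big (cbar L) predT) //= => s0; rewrite -[RHS]s0.
by apply: eq_bigr => C' _; apply: eq_bigr => y /eqP->.
Qed.

Lemma emb_E_separating : E_separating emb.
Proof.
apply: gal_E_separating; first exact: emb_linear.
  move=> t /(_ (cbar L 1%g)); rewrite emb_base => t0.
  by apply: val_inj; rewrite /= t0.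
by move=> g C; exists (coset_translate g C) => t; rewrite emb_translate.
Qed.

Lemma card_coset_space : #|X| = \dim {:LK}.
Proof.
apply: card_E_independent; first exact: emb_linear.
  exact: emb_independent.
exact: emb_E_separating.
Qed.

End Galois.

(** * A Hopf-Galois structure is determined by its operators *)

Lemma scalar_inj (K : fieldType) (A : falgType K) :
  injective (fun k : K => k%:A : A).
Proof.
move=> a b /= /eqP; rewrite -subr_eq0 -scalerBl scaler_eq0 oner_eq0 orbF.
by rewrite subr_eq0 => /eqP.
Qed.

Lemma tens_basis_free (K : fieldType) (V W : vectType K)
    (a : 'I_(\dim {:W}) -> V) :
  \sum_k tens (a k) (vbasis {:W})`_k = 0 -> forall k, a k = 0.
Proof.
move=> sum0 k; rewrite (coord_vbasis (memvf (a k))) big1 // => j _.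
pose phi : 'Hom(V, K^o) := linfun (coord (vbasis {:V}) j : V -> K^o).
have := congr1 (fun u : tensor V W => u phi) sum0; rewrite zero_lfunE sum_lfunE.
under eq_bigr => i _ do rewrite tensE.
have /freeP free_b := basis_free (vbasisP {:W}).
by move/free_b/(_ k); rewrite lfunE /= => ->; rewrite scale0r.
Qed.

Section Antipode.
Variables (K : fieldType) (H : hopfAlgebra K).

Lemma linear_mull (a : H) : linear (fun b => a * b).
Proof. by move=> k b c; rewrite mulrDr scalerAr. Qed.

Lemma linear_mulr (b : H) : linear (fun a => a * b).
Proof. by move=> k a c; rewrite mulrDl scalerAl. Qed.

(* Convolution: T = T * (id * S) = (T * id) * S = S. *)
Lemma antipode_unique (T : 'End(H)) :
  (forall h, tlift (fun a b => T a * b) (comul H h) = (counit H h : K)%:A) ->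
  forall h, T h = antipode H h.
Proof.
move=> T_id h.
have lin_cS c : linear (fun d : H => c * antipode H d).
  by move=> k d d'; rewrite linearP mulrDr scalerAr.
have lin_cS' d : linear (fun c : H => c * antipode H d) by apply: linear_mulr.
pose Phi := tlift (fun a w => T a * tlift (fun c d => c * antipode H d) w).
have lin_in a : linear (fun w => T a * tlift (fun c d => c * antipode H d) w).
  by move=> k w w'; rewrite tlift_linear // mulrDr scalerAr.
have lin_out w : linear (fun a => T a * tlift (fun c d => c * antipode H d) w).
  by move=> k a a'; rewrite linearP mulrDl scalerAl.
have lin_Phi : linear Phi by apply: tlift_linear.
have := congr1 Phi (comulA h); rewrite !(tlift_comp _ _ lin_Phi).
under eq_tlift => a b.
  rewrite (tlift_comp _ _ lin_Phi).
  under eq_tlift => c d.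
    rewrite /Phi tlift_tens // tlift_tens // mulrA.
  over.
  rewrite -(tlift_comp (j := fun x => x * antipode H b)); last exact: linear_mulr.
  rewrite T_id mulr_algl -linearZ.
over.
rewrite -(tlift_comp _ _ (linearP (antipode H))) counitl => ->.
under eq_tlift => a b.
  rewrite /Phi tlift_tens // antipoder mulr_algr -linearZ.
over.
by rewrite -(tlift_comp _ _ (linearP T)) counitr.
Qed.

End Antipode.

Section HopfGalois.
Variables (K : fieldType) (L : fieldExtType K).

Lemma hg_canonical_linear (H : hopfGalois L) :
  linear (tlift (fun (l : L) (h : H) => (amull l \o hg_act H h)%VF)).
Proof.
apply: tlift_linear => l k h h'.
by rewrite linearP comp_lfunDr -comp_lfunZr.
Qed.

(** Injectivity of the canonical map: a relation with coefficients a k in L says that the sum of the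
    tensors of a k with the k-th basis vector of H acts as zero. *)
Lemma hg_act_E_separating (H : hopfGalois L) :
  E_separating (fun (s : L) (h : H) => hg_act H h s).
Proof.
move=> a a0; apply: (@tens_basis_free _ L H).
have [g canK _] := hg_bij H.
apply: (can_inj canK); rewrite linear_fun0; last exact: hg_canonical_linear.
rewrite linear_fun_sum; last exact: hg_canonical_linear.
apply/lfunP => s; rewrite sum_lfunE zero_lfunE -[RHS](a0 s).
apply: eq_bigr => k _; rewrite tlift_tens ?comp_lfunE ?lfunE //.
  by move=> l c h h'; rewrite linearP comp_lfunDr -comp_lfunZr.
by move=> h c l l'; rewrite linearP comp_lfunDl -comp_lfunZl.
Qed.

Lemma hg_act_linear (H : hopfGalois L) (s : L) :
  linear (fun h : H => hg_act H h s).
Proof. by move=> k h h'; rewrite linearP add_lfunE scale_lfunE. Qed.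

Lemma hg_act_separating (H : hopfGalois L) :
  separating (fun (s : L) (h : H) => hg_act H h s).
Proof.
apply: E_separating_separating; first exact: hg_act_linear.
exact: hg_act_E_separating.
Qed.

Lemma hg_act_inj (H : hopfGalois L) : injective (hg_act H).
Proof.
move=> h k eqhk; apply: (separating_eq (@hg_act_linear H) (@hg_act_separating H)).
by move=> s; rewrite eqhk.
Qed.

Lemma hg_dim (H : hopfGalois L) : \dim {:H} = \dim {:L}.
Proof.
have := bijective_dim (@hg_canonical_linear H) (hg_bij H).
by rewrite dim_tensor dim_End => /eqP; rewrite eqn_pmul2l ?adim_gt0 // => /eqP.
Qed.

Lemma hg_tensor_eq (H : hopfGalois L) (u v : tensor H H) :
  (forall s t, tlift (fun a b => hg_act H a s * hg_act H b t) u =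
               tlift (fun a b => hg_act H a s * hg_act H b t) v) -> u = v.
Proof.
move=> equv.
have sep := tensor_separating (@hg_act_linear H) (@hg_act_E_separating H)
  (@hg_act_separating H).
apply: (separating_eq _ sep) => [[s t]|[s t]]; last exact: equv.
exact/tlift_linear_mul/hg_act_linear.
Qed.

Lemma hg_iso_limg (H H1 : hopfGalois L) :
  hg_iso H H1 -> limg (hg_act H) = limg (hg_act H1).
Proof.
case=> F [[F' FK F'K] _ _ _ actF]; apply/vspaceP => f.
apply/memv_imgP/memv_imgP => [[h _ ->]|[h _ ->]].
  by exists (F h); rewrite ?memvf ?actF.
by exists (F' h); rewrite ?memvf // -actF F'K.
Qed.

(** Both actions are faithful, so [F] is forced. Products and units are compared as operators,
    comultiplications through [hg_tensor_eq], and counits by evaluation at 1. *)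
Lemma limg_hg_iso (H H1 : hopfGalois L) :
  limg (hg_act H) = limg (hg_act H1) -> hg_iso H H1.
Proof.
move=> eqimg; pose F : 'Hom(H, H1) := ((hg_act H1)^-1 \o hg_act H)%VF.
have actF h : hg_act H1 (F h) = hg_act H h.
  by rewrite /F comp_lfunE limg_lfunVK // -eqimg memv_img ?memvf.
have F_inj h : F h = 0 -> h = 0.
  by move=> Fh0; apply: hg_act_inj; rewrite -actF Fh0 !linear0.
have F_bij : bijective F by apply: bijective_lfun => //; rewrite !hg_dim.
have F_comul h : comul H1 (F h) = tlift (fun a b => tens (F a) (F b)) (comul H h).
  apply: hg_tensor_eq => s t; rewrite -hg_act_mul actF hg_act_mul.
  rewrite (tlift_comp (j := tlift _)); last exact/tlift_linear_mul/hg_act_linear.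
  apply: eq_tlift => a b; rewrite tlift_tens ?actF //.
    by move=> v; apply/linear_mull_fun/hg_act_linear.
  by move=> v; apply/linear_mulr_fun/hg_act_linear.
have F_counit h : counit H1 (F h) = counit H h.
  by apply: (@scalar_inj K L); rewrite -!hg_act_unit actF.
have F_mul h k : F (h * k) = F h * F k.
  by apply: hg_act_inj; rewrite hg_actM !actF hg_actM.
have F_1 : F 1 = 1 by apply: hg_act_inj; rewrite actF !hg_act1.
exists F; split=> // h.
have [F' FK F'K] := F_bij.
have lin_F' : linear F'.
  by move=> k a b; apply: (can_inj FK); rewrite linearP /= !F'K.
(* The antipode of H1 transported to H is again a left convolution inverse of the identity, so
   [antipode_unique] applies. *)
pose T : 'End(H) := linfun (fun h => F' (antipode H1 (F h))).
have TE a : T a = F' (antipode H1 (F a)).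
  by rewrite linfunE // => k x y; rewrite !linearP lin_F'.
rewrite -(antipode_unique (T := T)) ?TE ?F'K // => {}h.
apply: (can_inj FK); rewrite (tlift_comp _ _ (linearP F)) linearZ /= F_1.
rewrite -F_counit -antipodel F_comul.
rewrite [RHS](tlift_comp (j := tlift _)); last first.
  by apply: tlift_linear => a; apply: linear_mull.
apply: eq_tlift => a b; rewrite F_mul TE F'K tlift_tens //.
  by move=> c; apply: linear_mull.
by move=> c k x y; rewrite linearP mulrDl scalerAl.
Qed.

Lemma hg_isoE (H H1 : hopfGalois L) :
  hg_iso H H1 <-> limg (hg_act H) = limg (hg_act H1).
Proof. by split; [apply: hg_iso_limg | apply: limg_hg_iso]. Qed.

End HopfGalois.

(** * The Hopf-Galois structure of a bracoid operation *)

(** With the laws packed in a value, a single alias of V carries the algebra structures, even for a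
    product that depends on a variable [star]. *)
Record algebra_law (K : fieldType) (V : vectType K) := AlgebraLaw {
  law_mul : V -> V -> V;
  law_one : V;
  law_mulA : associative law_mul;
  law_mul1l : left_id law_one law_mul;
  law_mul1r : right_id law_one law_mul;
  law_linearl : forall v, linear (law_mul^~ v);
  law_linearr : forall v, linear (law_mul v);
  law_one_neq0 : law_one != 0
}.

Definition law_algebra (K : fieldType) (V : vectType K)
  (law : algebra_law V) : Type := V.

Section LawAlgebra.
Variables (K : fieldType) (V : vectType K) (law : algebra_law V).
Notation A := (law_algebra law).

HB.instance Definition _ := Vector.copy A V.

Let mulDl : left_distributive (law_mul law) +%R.
Proof. by move=> u v w; apply: (linear_funD (law_linearl law w)). Qed.

Let mulDr : right_distributive (law_mul law) +%R.
Proof. by move=> u v w; apply: (linear_funD (law_linearr law u)). Qed.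

HB.instance Definition _ := GRing.Zmodule_isNzRing.Build A
  (law_mulA law) (law_mul1l law) (law_mul1r law) mulDl mulDr (law_one_neq0 law).

Let scaleAl (k : K) (u v : A) : k *: (u * v) = (k *: u) * v.
Proof. by apply/esym/(linear_funZ (law_linearl law v)). Qed.

HB.instance Definition _ := GRing.Lmodule_isLalgebra.Build K A scaleAl.

Let scaleAr (k : K) (u v : A) : k *: (u * v) = u * (k *: v).
Proof. by apply/esym/(linear_funZ (law_linearr law u)). Qed.

HB.instance Definition _ := GRing.Lalgebra_isAlgebra.Build K A scaleAr.
HB.instance Definition _ := Algebra_isFalgebra.Build K A.

End LawAlgebra.

Section ScalarPart.
Variables (K : fieldType) (A : falgType K).

(** A linear retraction onto the scalars. It serves for the counit, where it is applied only to
    Galois-invariant elements, which are scalars. *)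
Definition scalar_part (a : A) : K := coord [tuple (1 : A)] ord0 a.

Lemma scalar_part_linear : linear (scalar_part : A -> K^o).
Proof. by move=> k a b; rewrite /scalar_part linearP. Qed.

Lemma scalar_partK k : scalar_part k%:A = k.
Proof.
rewrite /scalar_part linearZ /=.
have -> : coord [tuple (1 : A)] ord0 1 = 1.
  have f1 : free [tuple (1 : A)] by rewrite seq1_free oner_eq0.
  exact: (coord_free ord0 ord0 f1).
exact: mulr1.
Qed.

End ScalarPart.

(* The junk value x is only taken when x has no right inverse.  Locked because
   unification would otherwise unfold the search through the coset space. *)
HB.lock Definition star_inv (T : finType) (e : T) (star : T -> T -> T) (x : T) :=
  odflt x [pick w | star x w == e].

Section StarAlgebra.
Variables (K : fieldType) (E : splittingFieldType K).
Hypothesis galE : galois 1%AS {:E}.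
Variable L : {subfield E}.
Notation G := (gal_of {:E}).
Notation X := (coset_space L).
Notation LK := (subvs_of L).
Notation e := (cbar L 1%g).

(** Translation of cosets is always a transitive action of G, so only these two conditions constrain
    [star]; [star_inv] replaces the existentially quantified inverse. *)
Definition based_bracoid (star : X -> X -> X) :=
  group_axioms star e (star_inv e star) /\
  forall (g : G) x y, coset_translate g (star x y) =
    star (star (coset_translate g x) (star_inv e star (coset_translate g e)))
         (coset_translate g y).

Lemma based_bracoidI (star : X -> X -> X) (inv : X -> X) :
  group_axioms star e inv ->
  (forall (g : G) x y, coset_translate g (star x y) =
    star (star (coset_translate g x) (inv (coset_translate g e)))
         (coset_translate g y)) ->
  based_bracoid star.
Proof.
move=> [starA star1x starx1 starVx starxV] law.
have inv_eq x : inv x = star_inv e star x.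
  rewrite star_inv.unlock; case: pickP => [w /eqP xw|/(_ (inv x))].
    by rewrite -[LHS]starx1 -xw starA starVx star1x.
  by rewrite starxV eqxx.
by split=> [|g x y]; [split=> // x|]; rewrite -?inv_eq.
Qed.

Variable star : X -> X -> X.
Hypothesis bracoid : based_bracoid star.
Notation inv := (star_inv e star).

Let starA : associative star. Proof. by case: bracoid => [[]]. Qed.
Let star1x : left_id e star. Proof. by case: bracoid => [[]]. Qed.
Let starx1 : right_id e star. Proof. by case: bracoid => [[]]. Qed.
Let starVx : left_inverse e inv star. Proof. by case: bracoid => [[]]. Qed.
Let starxV : right_inverse e inv star. Proof. by case: bracoid => [[]]. Qed.
Let translate_star (g : G) x y : coset_translate g (star x y) =
    star (star (coset_translate g x) (inv (coset_translate g e)))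
         (coset_translate g y).
Proof. by case: bracoid. Qed.

Let starK x : cancel (star^~ x) (star^~ (inv x)).
Proof. by move=> y; rewrite /= -starA starxV starx1. Qed.
Let starVK x : cancel (star^~ (inv x)) (star^~ x).
Proof. by move=> y; rewrite /= -starA starVx starx1. Qed.
Let starI x : injective (star^~ x).
Proof. exact: can_inj (starK x). Qed.
Let inv_unique x y : star x y = e -> x = inv y.
Proof. by move=> xy; rewrite -(starK y x) xy star1x. Qed.
Let invK : involutive inv.
Proof. by move=> x; apply/esym/inv_unique; rewrite starxV. Qed.
Let inv_e : inv e = e.
Proof. by apply/esym/inv_unique; rewrite starx1. Qed.

(* The action of G on the group (X, star) by automorphisms; it corresponds to
   conjugation of left translations by lambda_odot g. *)
Definition star_conj (g : G) y :=
  star (coset_translate g y) (inv (coset_translate g e)).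
Notation gamma := star_conj.

Lemma translate_conj g x y :
  coset_translate g (star x y) = star (gamma g x) (coset_translate g y).
Proof. by rewrite translate_star. Qed.

Lemma star_conjM g x y : gamma g (star x y) = star (gamma g x) (gamma g y).
Proof. by rewrite {1}/star_conj translate_conj -starA. Qed.

Lemma star_conj_translate g y :
  star (gamma g y) (coset_translate g e) = coset_translate g y.
Proof. exact: starVK. Qed.

Lemma star_conj_comp g h y : gamma (gal_comp g h) y = gamma g (gamma h y).
Proof.
apply: (@starI (coset_translate (gal_comp g h) e)).
rewrite star_conj_translate !coset_translateM -translate_conj.
by rewrite star_conj_translate.
Qed.

Lemma star_conj1 y : gamma 1%g y = y.
Proof. by rewrite /star_conj !coset_translate1 inv_e starx1. Qed.

Lemma star_conjVK g : cancel (gamma g) (gamma g^-1%g).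
Proof. by move=> y; rewrite -star_conj_comp /gal_comp mulgV star_conj1. Qed.

Lemma star_conj_inj g : injective (gamma g).
Proof. exact: can_inj (star_conjVK g). Qed.

Lemma star_conje g : gamma g e = e.
Proof. exact: starxV. Qed.

Lemma star_conjV g y : gamma g (inv y) = inv (gamma g y).
Proof. by apply: inv_unique; rewrite -star_conjM starVx star_conje. Qed.

(** Elements of Gal(E/L) fix the base coset. Hence the values of an equivariant combination of
    embeddings are fixed by Gal(E/L), that is, they lie in L. *)
Lemma star_conj_stab h y :
  h \in 'Gal({:E} / L)%g -> gamma h y = coset_translate h y.
Proof.
by move=> hL; rewrite /star_conj coset_translate_base // inv_e starx1.
Qed.

Definition equivariant (c : X -> E) :=
  forall (g : G) y, g (c y) = c (gamma g y).

Let reindex_star (F : X -> E) w : \sum_z F z = \sum_z F (star z w).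
Proof. exact: (reindex_inj (@starI w)). Qed.

(* The image of E[X]^G in End_K(L). *)
Definition star_operator (f : 'End(LK)) := exists c, equivariant c /\
  forall t, vsval (f t) = \sum_y c y * emb y t.

(** Choose g with g e = x and apply it to the formula at e. Equivariance turns c y into c (gamma g
    y), while g y = star (gamma g y) x; reindex by gamma g. *)
Lemma star_operator_emb c (f : 'End(LK)) x t : equivariant c ->
  (forall t, vsval (f t) = \sum_y c y * emb y t) ->
  emb x (f t) = \sum_y c y * emb (star y x) t.
Proof.
move=> eqc fE; have [g <-] := coset_translate_trans e x.
rewrite emb_translate emb_base fE rmorph_sum.
rewrite [RHS](reindex_inj (@star_conj_inj g)); apply: eq_bigr => y _.
by rewrite rmorphM /= eqc -emb_translate star_conj_translate.
Qed.

Section Carrier.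

Let defect (f : {ffun X -> E}) : {ffun G * X -> E} :=
  [ffun p : G * X => p.1 (f p.2) - f (gamma p.1 p.2)].

Let defect_linear : linear defect.
Proof.
move=> k f f'; apply/ffunP => p; rewrite !ffunE linearP /=.
by rewrite scalerBr opprD addrACA.
Qed.

(* E[X]^G.  Since y acts as the embedding y, composition of operators reverses
   star: the product given to this space is that of the group algebra of the
   opposite group of (X, star). *)
Definition equivariant_space : {vspace {ffun X -> E}} := lker (linfun defect).

Lemma mem_equivariant (f : {ffun X -> E}) :
  reflect (equivariant f) (f \in equivariant_space).
Proof.
rewrite memv_ker linfunE //; apply: (iffP eqP) => [/ffunP f0 g y|eqf].
  by move: (f0 (g, y)); rewrite !ffunE /= => /eqP; rewrite subr_eq0 => /eqP.
by apply/ffunP => p; rewrite !ffunE eqf subrr.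
Qed.

Notation V := (subvs_of equivariant_space).

Let mkV (c : X -> E) : V := vsproj equivariant_space [ffun y => c y].

Let mkVE c : equivariant c -> vsval (mkV c) =1 c.
Proof.
move=> eqc y; rewrite vsprojK ?ffunE //.
by apply/mem_equivariant => g z; rewrite !ffunE.
Qed.

Let V_equivariant (h : V) : equivariant (vsval h).
Proof. exact/mem_equivariant/subvsP. Qed.

Let V_ext (h k : V) : vsval h =1 vsval k -> h = k.
Proof. by move=> hk; apply/val_inj/ffunP. Qed.

Let mul_fun (h k : V) z := \sum_w vsval h w * vsval k (star z (inv w)).

Let mul_fun_equivariant h k : equivariant (mul_fun h k).
Proof.
move=> g z; rewrite rmorph_sum [RHS](reindex_inj (@star_conj_inj g)).
apply: eq_bigr => w _; rewrite rmorphM /= !V_equivariant.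
by rewrite star_conjM star_conjV.
Qed.

Let one_fun_equivariant : equivariant (fun y => (e == y)%:R).
Proof.
by move=> g y; rewrite rmorph_nat -{2}(star_conje g) (inj_eq (@star_conj_inj g)).
Qed.

Let mulV h k := mkV (mul_fun h k).
Let oneV := mkV (fun y => (e == y)%:R).

Let mulVE h k z :
  vsval (mulV h k) z = \sum_w vsval h w * vsval k (star z (inv w)).
Proof. exact/mkVE/mul_fun_equivariant. Qed.

Let oneVE z : vsval oneV z = (e == z)%:R.
Proof. exact/mkVE/one_fun_equivariant. Qed.

Let mulVA : associative mulV.
Proof.
move=> h k l; apply: V_ext => z; rewrite !mulVE.
under eq_bigr => w _ do rewrite mulVE mulr_sumr.
under [RHS]eq_bigr => w _ do rewrite mulVE mulr_suml.
rewrite [RHS]exchange_big; apply: eq_bigr => w _ /=.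
rewrite [RHS](@reindex_star _ w); apply: eq_bigr => v _.
rewrite mulrA starK; congr (_ * vsval l _).
rewrite -starA; congr (star z _); apply: inv_unique.
by rewrite starA starVK starVx.
Qed.

Let mul1V : left_id oneV mulV.
Proof.
move=> h; apply: V_ext => z; rewrite mulVE.
under eq_bigr => w _ do rewrite oneVE.
by rewrite sum_delta inv_e starx1.
Qed.

Let mulV1 : right_id oneV mulV.
Proof.
move=> h; apply: V_ext => z; rewrite mulVE.
under eq_bigr => w _.
  rewrite oneVE mulrC (_ : (e == _) = (z == w)); first over.
  by apply/eqP/eqP=> [/esym/inv_unique ->|->]; rewrite ?invK ?starxV.
by rewrite sum_delta.
Qed.

Let vsvalE k (h h' : V) y :
  vsval (k *: h + h') y = k *: vsval h y + vsval h' y.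
Proof. by rewrite linearP !ffunE. Qed.

Let mulV_linearl v : linear (mulV^~ v).
Proof.
move=> k h h'; apply: V_ext => z; rewrite vsvalE !mulVE scaler_sumr -big_split.
by apply: eq_bigr => w _; rewrite vsvalE mulrDl scalerAl.
Qed.

Let mulV_linearr v : linear (mulV v).
Proof.
move=> k h h'; apply: V_ext => z; rewrite vsvalE !mulVE scaler_sumr -big_split.
by apply: eq_bigr => w _; rewrite vsvalE mulrDr scalerAr.
Qed.

Let oneV_neq0 : oneV != 0.
Proof.
apply/eqP => /(congr1 (fun h : V => vsval h e)); rewrite oneVE eqxx.
by rewrite linear0 ffunE => /eqP; rewrite oner_eq0.
Qed.

(* H is E[X]^G, seen only through the coefficients co y h of its elements. *)
Record star_algebra (H : falgType K) (co : X -> H -> E) (elt : (X -> E) -> H) :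
    Prop := StarAlgebra {
  co_linear : forall y, linear (co y);
  co_separating : separating co;
  co_equivariant : forall (g : G) h y, g (co y h) = co (gamma g y) h;
  co_elt : forall c y, equivariant c -> co y (elt c) = c y;
  co1 : forall z, co z (1 : H) = (e == z)%:R;
  coM : forall (h k : H) z, co z (h * k) = \sum_w co w h * co (star z (inv w)) k
}.

Lemma star_algebra_exists :
  exists (H : falgType K) co elt, @star_algebra H co elt.
Proof.
pose H : falgType K := law_algebra
  (AlgebraLaw mulVA mul1V mulV1 mulV_linearl mulV_linearr oneV_neq0).
exists H, (fun y (h : V) => vsval h y), mkV; split=> //.
- by move=> y k h h'; apply: vsvalE.
- by move=> h h0; apply: V_ext => y; rewrite linear0 ffunE; apply: h0.
- by move=> g h y; apply: V_equivariant.
- by move=> c y eqc; apply: mkVE.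
Qed.

End Carrier.

(** * The action of equivariant functions on L *)

Section Coefficients.
Variables (H : falgType K) (co : X -> H -> E) (elt : (X -> E) -> H).
Hypothesis coH : star_algebra co elt.

Lemma star_coef_eq h k : (forall y, co y h = co y k) -> h = k.
Proof. exact: (separating_eq (co_linear coH) (co_separating coH)). Qed.

Lemma star_coef_independent : E_independent co.
Proof.
move=> a a0 z.
have := @gal_independent _ _ {:E}%AS predT (fun g : G => a (gamma g z)).
move/(_ _ 1%g isT); rewrite star_conj1; apply=> s _.
(* The orbit sum of s times the indicator of z, the simplest equivariant function. On it the
   relation reads: the sum of a (gamma g z) * g s is 0 for all s. Dedekind independence at g = 1
   gives a z = 0. *)
pose c y := \sum_(g : G) (gamma g z == y)%:R * g s.
have eqc : equivariant c.
  move=> h y; rewrite rmorph_sum /c [RHS](reindex_inj (mulIg h)).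
  apply: eq_bigr => g _.
  rewrite -[(g * h)%g]/(gal_comp h g) star_conj_comp (inj_eq (@star_conj_inj h)).
  by rewrite gal_compE; case: eqP; rewrite ?mul1r ?mul0r ?rmorph0.
rewrite -[RHS](a0 (elt c)).
under [RHS]eq_bigr => y _ do rewrite (co_elt coH) // mulr_sumr.
rewrite exchange_big; apply: eq_bigr => g _ /=.
under eq_bigr => y _ do rewrite mulrCA.
by rewrite sum_delta.
Qed.

Lemma star_coef_E_separating : E_separating co.
Proof.
apply: gal_E_separating => //; first exact: (co_linear coH).
  exact: (co_separating coH).
by move=> g y; exists (gamma g y) => h; rewrite (co_equivariant coH).
Qed.

Lemma star_algebra_dim : \dim {:H} = \dim {:LK}.
Proof.
rewrite -card_coset_space //; apply/esym/card_E_independent.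
- exact: (co_linear coH).
- exact: star_coef_independent.
- exact: star_coef_E_separating.
Qed.

Let LK_eq (s t : LK) : vsval s = vsval t -> s = t.
Proof. exact: val_inj. Qed.

Let act_fun (h : H) (t : LK) := \sum_y co y h * emb y t.

Let act_funE h t : vsval (vsproj L (act_fun h t)) = act_fun h t.
Proof.
rewrite vsprojK //; apply: gal_invariant_subfield => // g gL.
rewrite rmorph_sum [RHS](reindex_inj (@star_conj_inj g)); apply: eq_bigr => y _.
by rewrite rmorphM /= (co_equivariant coH) -emb_translate (star_conj_stab _ gL).
Qed.

Let act_fun_linear h : linear (act_fun h).
Proof. by apply: linear_sum_fun => y; apply/linear_mull_fun/emb_linear. Qed.

Definition star_act (h : H) : 'End(LK) :=
  linfun (fun t => vsproj L (act_fun h t)).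

Lemma star_actE h t : vsval (star_act h t) = \sum_y co y h * emb y t.
Proof.
by rewrite linfunE ?act_funE // => k s s'; rewrite act_fun_linear linearP.
Qed.

Lemma star_act_linear : linear star_act.
Proof.
move=> k h h'; apply/lfunP => t; rewrite add_lfunE scale_lfunE.
apply: LK_eq; rewrite [RHS]linearP /= !star_actE scaler_sumr -big_split.
by apply: eq_bigr => y _; rewrite (co_linear coH) mulrDl scalerAl.
Qed.

Lemma emb_star_act x h t :
  emb x (star_act h t) = \sum_y co y h * emb (star y x) t.
Proof.
apply: star_operator_emb; last exact: star_actE.
by move=> g y; apply: (co_equivariant coH).
Qed.

Let star_act1 : star_act (1 : H) = \1%VF.
Proof.
apply/lfunP => t; apply: LK_eq; rewrite star_actE id_lfunE.
under eq_bigr => y _ do rewrite (co1 coH).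
by rewrite sum_delta emb_base.
Qed.

Let star_actM (h k : H) : star_act (h * k) = (star_act h \o star_act k)%VF.
Proof.
apply/lfunP => t; apply: LK_eq; rewrite comp_lfunE !star_actE.
under [RHS]eq_bigr => w _ do rewrite emb_star_act mulr_sumr.
under [LHS]eq_bigr => z _ do rewrite (coM coH) mulr_suml.
rewrite exchange_big; apply: eq_bigr => w _ /=.
rewrite (@reindex_star _ w); apply: eq_bigr => y _.
by rewrite starK mulrA.
Qed.

(** Dimensions agree, so injectivity suffices. Under [emb x] the operator of a tensor u is a
    combination of the embeddings z, whose coefficients vanish when the operator does. Since z =
    star y x reaches every y, these coefficients are all the coordinates of u that
    [tensor_separating] requires. *)
Lemma star_act_bij :
  bijective (tlift (fun (l : LK) (h : H) => (amull l \o star_act h)%VF)).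
Proof.
have lin_r (l : LK) : linear (fun h : H => (amull l \o star_act h)%VF).
  by move=> k h h'; rewrite star_act_linear comp_lfunDr -comp_lfunZr.
have lin : linear (tlift (fun (l : LK) (h : H) => (amull l \o star_act h)%VF)).
  exact: tlift_linear.
apply: bijective_linear => //.
  by rewrite dim_tensor dim_End star_algebra_dim.
move=> u u0; have sep := tensor_separating (co_linear coH)
  (emb_E_separating galE (L := L)) (co_separating coH).
apply: sep => -[x y] /=.
suff : forall z, tlift (fun v w => emb x v * co (star z (inv x)) w) u = 0.
  by move/(_ (star y x)); rewrite starK.
apply: (emb_independent galE) => t.
have := congr1 (fun f : 'End(LK) => emb x (f t)) u0.
rewrite zero_lfunE (linear_fun0 (emb_linear x)) => {2}<-.
rewrite (tlift_comp (j := fun f : 'End(LK) => emb x (f t))); last first.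
  by move=> k f f'; rewrite add_lfunE scale_lfunE emb_linear.
under [RHS]eq_tlift => l h.
  rewrite comp_lfunE lfunE /= embM emb_star_act mulr_sumr.
  rewrite (@reindex_star _ (inv x)).
  under eq_bigr => z _ do rewrite starVK mulrA mulrC.
over.
rewrite tlift_sum; apply: eq_bigr => z _.
by rewrite tlift_mull mulrC.
Qed.


(** * Comultiplication, counit and antipode of E[X]^G *)

Section DualBasis.
Variable D : X -> 'I_(\dim {:H}) -> E.
Hypothesis dualD : dual_family co D.

(* The E-linear extension of phi, evaluated at the group element y. *)
Let ext (phi : 'Hom(H, K^o)) y :=
  \sum_k D y k * ((phi (vbasis {:H})`_k : K)%:A : E).

Let extE (phi : 'Hom(H, K^o)) h :
  (phi h : K)%:A = \sum_y ext phi y * co y h :> E.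
Proof.
apply: (dualD.2 (fun h => (phi h : K)%:A)) => a x y.
by rewrite linearP /= scalerDl scalerA.
Qed.

Let ext_equivariant phi : equivariant (ext phi).
Proof.
(* Twisting the expansion of phi h by g gives another expansion of the same element, since phi h
   lies in K; coefficients are unique. *)
move=> g y; pose a z := g (ext phi (gamma g^-1%g z)).
suff /(_ (gamma g y)) : a =1 ext phi by rewrite /a star_conjVK.
apply: E_independent_eq star_coef_independent _ => h.
rewrite -extE [LHS](reindex_inj (@star_conj_inj g)).
have -> : (phi h : K)%:A = g ((phi h : K)%:A : E) by rewrite linearZ /= rmorph1.
rewrite extE rmorph_sum; apply: eq_bigr => z _.
by rewrite /a star_conjVK rmorphM /= (co_equivariant coH).
Qed.

Let ext_linear y : linear (fun phi : 'Hom(H, K^o) => ext phi y : E).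
Proof.
move=> a p q; rewrite /ext scaler_sumr -big_split; apply: eq_bigr => k _.
by rewrite add_lfunE scale_lfunE scalerDl mulrDr -scalerA -scalerAr.
Qed.

(** Points of X are to be grouplike: the sum of h_y y goes to the sum of h_y y (x) y. A tensor is a
    map on the dual of its first factor, so this is the contraction with [phi], the sum of h_y
    phi(y) y. *)
Let comul_fun (h : H) (phi : 'Hom(H, K^o)) : H :=
  elt (fun y => co y h * ext phi y).

Let comul_funE h phi y : co y (comul_fun h phi) = co y h * ext phi y.
Proof.
apply: (co_elt coH) => g z.
by rewrite rmorphM /= (co_equivariant coH) ext_equivariant.
Qed.

Let comul_tensor (h : H) : tensor H H := linfun (comul_fun h).

Let comul_tensorE h phi y : co y (comul_tensor h phi) = co y h * ext phi y.
Proof.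
rewrite linfunE ?comul_funE // => a p q; apply: star_coef_eq => z.
by rewrite (co_linear coH) !comul_funE ext_linear mulrDr scalerAr.
Qed.

Let comul_linear : linear comul_tensor.
Proof.
move=> a h h'; apply/lfunP => phi; rewrite add_lfunE scale_lfunE.
apply: star_coef_eq => y; rewrite (co_linear coH) !comul_tensorE.
by rewrite (co_linear coH) mulrDl scalerAl.
Qed.

Let comulH : 'Hom(H, tensor H H) := linfun comul_tensor.

Let comulHE h : comulH h = comul_tensor h.
Proof. exact: linfunE. Qed.

Lemma comul_coef y z h :
  tlift (fun a b => co y a * co z b) (comulH h) = (y == z)%:R * co y h.
Proof.
rewrite comulHE /tlift; set b := vbasis _.
under eq_bigr => k _ do rewrite comul_tensorE mulrCA.
rewrite -mulr_sumr mulrC.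
(* The extension of the k-th coordinate form takes the value [D z k] at z, so the sum is the
   defining relation of the dual family. *)
have -> : \sum_(k < \dim {:H}) co y b`_k * ext (linfun (coord b k : H -> K^o)) z =
    (y == z)%:R; last first.
  by case: eqP => [->|]; rewrite ?mul0r.
rewrite eq_sym -(dualD.1 z y); apply: eq_bigr => k _; rewrite mulrC.
congr (_ * _); rewrite /ext (bigD1 k) //= big1 ?addr0.
  rewrite lfunE /= coord_free ?(basis_free (vbasisP _)) //.
  by rewrite eqxx scale1r mulr1.
move=> j jk; rewrite lfunE /= coord_free ?(basis_free (vbasisP _)) //.
by rewrite (negPf jk) scale0r mulr0.
Qed.

Lemma tlift_comul (U : X -> X -> E) h :
  tlift (fun a b => \sum_y \sum_z U y z * (co y a * co z b)) (comulH h) =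
  \sum_y U y y * co y h.
Proof.
rewrite tlift_sum; apply: eq_bigr => y _; rewrite tlift_sum.
under eq_bigr => z _ do rewrite tlift_mull comul_coef mulrCA.
by rewrite sum_delta.
Qed.

Let counit_fun (h : H) : K^o := scalar_part (\sum_y co y h).

Let counit_lin : linear counit_fun.
Proof.
move=> a h k; rewrite /counit_fun -scalar_part_linear.
by rewrite (linear_sum_fun (index_enum X) (co_linear coH)).
Qed.

Let counitH : 'Hom(H, K^o) := linfun counit_fun.

Let counitHE h : (counitH h : K)%:A = \sum_y co y h :> E.
Proof.
rewrite linfunE // /counit_fun.
have [|k ->] := @gal_invariant_scalar _ _ galE (\sum_y co y h); last first.
  by rewrite scalar_partK.
move=> g; rewrite rmorph_sum [RHS](reindex_inj (@star_conj_inj g)).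
by apply: eq_bigr => y _; rewrite -(co_equivariant coH).
Qed.

Let antipode_fun (h : H) : H := elt (fun y => co (inv y) h).

Let antipode_funE h y : co y (antipode_fun h) = co (inv y) h.
Proof.
apply: (co_elt coH) => g z.
by rewrite (co_equivariant coH) star_conjV.
Qed.

Let antipodeH : 'End(H) := linfun antipode_fun.

Let antipodeHE h y : co y (antipodeH h) = co (inv y) h.
Proof.
rewrite linfunE ?antipode_funE // => a k k'; apply: star_coef_eq => z.
by rewrite (co_linear coH) !antipode_funE (co_linear coH).
Qed.

Let scalar_co (a : K) h y : co y (a *: h) = a%:A * co y h.
Proof. by rewrite (linear_funZ (co_linear coH y)) mulr_algl. Qed.

Let coHH_lin (yz : X * X) : linear (tlift (fun a b => co yz.1 a * co yz.2 b)).
Proof. exact/tlift_linear_mul/(co_linear coH). Qed.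

Let coHH_separating :
  separating (fun yz : X * X => tlift (fun a b => co yz.1 a * co yz.2 b)).
Proof.
exact: tensor_separating (co_linear coH) star_coef_E_separating (co_separating coH).
Qed.

Let coHH_tens y z a b :
  tlift (fun a b => co y a * co z b) (tens a b) = co y a * co z b.
Proof.
apply: tlift_tens => v; first exact/linear_mull_fun/(co_linear coH).
exact/linear_mulr_fun/(co_linear coH).
Qed.

(** Both sides have coefficient [co x h] at (x, y, z) when x = y = z and 0 otherwise. *)
Let comulH_coassoc h :
  tlift (fun a b => tlift (fun c d => tens c (tens d b)) (comulH a)) (comulH h)
  = tlift (fun a b => tens a (comulH b)) (comulH h).
Proof.
have sep := tensor_separating coHH_lin star_coef_E_separating coHH_separating.
have lin (x : X) (yz : X * X) : linear
    (tlift (fun a w => co x a * tlift (fun a b => co yz.1 a * co yz.2 b) w)).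
  exact: tlift_linear_mul.
apply: (separating_eq _ sep) => [[x yz]|[x [y z]]]; first exact: lin.
rewrite !(tlift_comp _ _ (lin x (y, z))) /=.
have tensE3 a w : tlift (fun a w => co x a * tlift (fun a b => co y a * co z b) w)
    (tens a w) = co x a * tlift (fun a b => co y a * co z b) w.
  apply: tlift_tens => v; first exact/linear_mull_fun/(coHH_lin (y, z)).
  exact/linear_mulr_fun/(co_linear coH).
under [RHS]eq_tlift => a b do rewrite tensE3 comul_coef mulrCA.
under [LHS]eq_tlift => a b.
  rewrite (tlift_comp _ _ (lin x (y, z))) /=.
  under eq_tlift => c d do rewrite tensE3 coHH_tens mulrA mulrC.
  rewrite tlift_mull comul_coef mulrC -mulrA.
over.
rewrite !tlift_mull !comul_coef.
by case: (x =P y) => [<-|_]; rewrite ?mul1r ?mul0r ?mulr0.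
Qed.

Let counit_l h : tlift (fun a b => (counitH a : K) *: b) (comulH h) = h.
Proof.
apply: star_coef_eq => z; rewrite (tlift_comp _ _ (co_linear coH z)).
under eq_tlift => a b do rewrite scalar_co counitHE mulr_suml.
rewrite tlift_sum; under eq_bigr => y _ do rewrite comul_coef eq_sym.
exact: sum_delta.
Qed.

Let counit_r h : tlift (fun a b => (counitH b : K) *: a) (comulH h) = h.
Proof.
apply: star_coef_eq => z; rewrite (tlift_comp _ _ (co_linear coH z)).
under eq_tlift => a b do rewrite scalar_co counitHE mulr_suml.
rewrite tlift_sum; under eq_bigr => y _.
  under eq_tlift => a b do rewrite mulrC.
  rewrite comul_coef.
over.
exact: sum_delta.
Qed.

Let comul_1 : comulH 1 = tens (1 : H) (1 : H).
Proof.
apply: (separating_eq coHH_lin coHH_separating) => -[y z] /=.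
rewrite comul_coef coHH_tens !(co1 coH).
by case: (e =P y) => [<-|_]; rewrite ?mul0r ?mulr0 // mulrC.
Qed.

Let comul_M (h k : H) : comulH (h * k) = tensor_mul (comulH h) (comulH k).
Proof.
apply: (separating_eq coHH_lin coHH_separating) => -[y z] /=.
rewrite comul_coef (coM coH) /tensor_mul (tlift_comp _ _ (coHH_lin (y, z))) /=.
(* The factor contributed by the comultiplication of k. The comultiplication of h then keeps only w
   = v, where cancelling on the right reduces the condition to y = z. *)
pose U w v := (star y (inv w) == star z (inv v))%:R * co (star y (inv w)) k.
transitivity (tlift (fun a b => \sum_w \sum_v U w v * (co w a * co v b))
    (comulH h)); last first.
  apply: eq_tlift => a b; rewrite (tlift_comp _ _ (coHH_lin (y, z))) /=.
  under [RHS]eq_tlift => a' b'.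
    rewrite coHH_tens !(coM coH) mulr_suml.
    under eq_bigr => w _.
      rewrite mulr_sumr.
      under eq_bigr => v _ do rewrite mulrACA.
    over.
  over.
  rewrite tlift_sum; apply: eq_bigr => w _; rewrite tlift_sum.
  by apply: eq_bigr => v _; rewrite tlift_mull comul_coef mulrC.
rewrite tlift_comul mulr_sumr; apply: eq_bigr => w _.
by rewrite /U (inj_eq (@starI _)) -mulrA [co _ k * _]mulrC.
Qed.

Let counit_1 : counitH 1 = 1.
Proof.
apply: (@scalar_inj K E); rewrite counitHE scale1r.
under eq_bigr => y _ do rewrite (co1 coH) -[_%:R]mulr1.
exact: sum_delta.
Qed.

Let counit_M (h k : H) : counitH (h * k) = counitH h * counitH k.
Proof.
apply: (@scalar_inj K E); rewrite counitHE.
have -> : ((counitH h : K) * (counitH k : K))%:A =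
    (counitH h : K)%:A * (counitH k : K)%:A :> E.
  by rewrite mulr_algl scalerA.
rewrite !counitHE mulr_suml.
under eq_bigr => z _ do rewrite (coM coH).
rewrite exchange_big; apply: eq_bigr => w _; rewrite /= -mulr_sumr.
rewrite (@reindex_star _ w); congr (_ * _).
by apply: eq_bigr => z _; rewrite starK.
Qed.

Let inv_inj : injective inv.
Proof. exact: can_inj invK. Qed.

Let antipode_l h :
  tlift (fun a b => antipodeH a * b) (comulH h) = (counitH h : K)%:A.
Proof.
apply: star_coef_eq => z; rewrite (tlift_comp _ _ (co_linear coH z)).
rewrite scalar_co counitHE (co1 coH).
under eq_tlift => a b.
  rewrite (coM coH); under eq_bigr => w _ do rewrite antipodeHE.
over.
rewrite tlift_sum mulrC mulr_sumr [RHS](reindex_inj inv_inj).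
apply: eq_bigr => w _; rewrite comul_coef; congr (_%:R * _).
by rewrite -{1}[inv w]star1x (inj_eq (@starI _)).
Qed.

Let antipode_r h :
  tlift (fun a b => a * antipodeH b) (comulH h) = (counitH h : K)%:A.
Proof.
apply: star_coef_eq => z; rewrite (tlift_comp _ _ (co_linear coH z)).
rewrite scalar_co counitHE (co1 coH).
under eq_tlift => a b.
  rewrite (coM coH); under eq_bigr => w _ do rewrite antipodeHE.
over.
rewrite tlift_sum mulrC mulr_sumr.
apply: eq_bigr => w _; rewrite comul_coef; congr (_%:R * _).
by rewrite -(inj_eq inv_inj) invK -{1}[inv w]star1x (inj_eq (@starI _)).
Qed.

Definition star_hopf : hopfAlgebra K :=
  HopfAlgebra comulH_coassoc counit_l counit_r comul_1 comul_M counit_1 counit_M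
    antipode_l antipode_r.

Let act_hom : 'Hom(H, 'End(LK)) := linfun star_act.

Let act_homE h : act_hom h = star_act h.
Proof. exact/linfunE/star_act_linear. Qed.

Let act_hom1 : act_hom 1 = \1%VF.
Proof. by rewrite act_homE star_act1. Qed.

Let act_homM h k : act_hom (h * k) = (act_hom h \o act_hom k)%VF.
Proof. by rewrite !act_homE star_actM. Qed.

Let act_hom_unit h : act_hom h 1 = (counitH h : K)%:A.
Proof.
apply: LK_eq; rewrite act_homE star_actE linearZ /= algid1 counitHE.
by apply: eq_bigr => y _; rewrite emb1 mulr1.
Qed.

Let act_hom_mul h s t :
  act_hom h (s * t) = tlift (fun a b => act_hom a s * act_hom b t) (comulH h).
Proof.
apply: LK_eq; rewrite act_homE star_actE (tlift_comp (j := vsval)); last exact: linearP.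
transitivity (tlift (fun a b => \sum_y \sum_z
    (emb y s * emb z t) * (co y a * co z b)) (comulH h)).
  by rewrite tlift_comul; apply: eq_bigr => y _; rewrite embM mulrC.
apply: eq_tlift => a b; rewrite rmorphM /= !act_homE !star_actE mulr_suml.
apply: eq_bigr => y _; rewrite mulr_sumr; apply: eq_bigr => z _.
by rewrite mulrC mulrACA.
Qed.

Let act_hom_bij :
  bijective (tlift (fun (l : LK) (h : H) => (amull l \o act_hom h)%VF)).
Proof.
apply: (eq_bij star_act_bij) => u; apply: eq_tlift => l h.
by rewrite act_homE.
Qed.

Definition star_hopf_galois : hopfGalois LK :=
  @HopfGalois _ _ star_hopf act_hom act_hom1 act_homM act_hom_unit act_hom_mul
    act_hom_bij.

Lemma star_hopf_galois_limg f :
  f \in limg (hg_act star_hopf_galois) <-> star_operator f.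
Proof.
split=> [/memv_imgP[h _ ->]|[c [eqc fE]]].
  exists (co^~ h); split=> [g y|t]; first exact: (co_equivariant coH).
  by rewrite -star_actE -act_homE.
apply/memv_imgP; exists (elt c : star_hopf_galois); rewrite ?memvf //=.
apply/lfunP => t; apply: LK_eq; rewrite fE /= act_homE star_actE.
by apply: eq_bigr => y _; rewrite (co_elt coH).
Qed.

End DualBasis.

Lemma star_act_operator h : star_operator (star_act h).
Proof.
exists (co^~ h); split=> [g y|t]; first exact: (co_equivariant coH).
exact: star_actE.
Qed.

End Coefficients.

Lemma star_hopf_galois_exists : exists Hg : hopfGalois LK,
  forall f, f \in limg (hg_act Hg) <-> star_operator f.
Proof.
have [H [co [elt coH]]] := star_algebra_exists.
have [|D dualD] := dual_family_exists (co_linear coH) (star_coef_independent coH).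
  by rewrite (star_algebra_dim coH) card_coset_space.
exists (star_hopf_galois coH dualD); exact: star_hopf_galois_limg.
Qed.

End StarAlgebra.

(** Let h act through [star]. Its coefficients at e agree with those of the same operator for
    [star']. At x, the coefficient of the embedding z is the one at e indexed by z divided by x, in
    either group. Independence of the embeddings, then of the coefficient functions [co], makes the
    two quotients equal, and division determines the product. *)
Lemma star_operator_inj (K : fieldType) (E : splittingFieldType K)
    (galE : galois 1%AS {:E}) (L : {subfield E}) star star'
    (B : @based_bracoid K E L star) (B' : @based_bracoid K E L star') :
  (forall f, star_operator star f -> star_operator star' f) ->
  forall x y, star x y = star' x y.
Proof.
pose inv := star_inv (cbar L 1%g) star.
pose inv' := star_inv (cbar L 1%g) star'.
move=> sub y x; have [H [co [elt coH]]] := star_algebra_exists B.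
have [[starA _ starx1 starVx starxV] _] := B.
have [[starA' _ starx1' starVx' starxV'] _] := B'.
have inj (s : coset_space L -> coset_space L -> coset_space L) i :
    associative s -> right_id (cbar L 1%g) s ->
    right_inverse (cbar L 1%g) i s ->
    injective (s^~ x).
  move=> sA s1 sV; apply: (@can_inj _ _ _ (s^~ (i x))) => z.
  by rewrite -sA sV s1.
suff eq_inv z : star z (inv x) = star' z (inv' x).
  have := eq_inv (star y x); rewrite -starA starxV starx1 => yE.
  by rewrite [in RHS]yE -starA' starVx' starx1'.
apply: (E_independent_inj (star_coef_independent B coH)) => h.
have [c' [eqc' c'E]] := sub _ (star_act_operator galE B coH h).
have c'_co : c' =1 co^~ h.
  apply: E_independent_eq (emb_independent galE (L := L)) _ => t.
  by rewrite -[LHS]c'E (star_actE galE B coH).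
have := E_independent_eq (a := fun z => co (star z (inv x)) h)
  (b := fun z => co (star' z (inv' x)) h)
  (emb_independent galE (L := L)).
apply=> t; transitivity (emb x (star_act co h t)).
  rewrite (emb_star_act galE B coH) (reindex_inj (inj _ _ starA starx1 starxV)).
  by apply: eq_bigr => w _; rewrite -starA starxV starx1.
rewrite (star_operator_emb B' _ _ eqc' c'E).
rewrite [RHS](reindex_inj (inj _ _ starA' starx1' starxV')).
by apply: eq_bigr => w _; rewrite c'_co -starA' starxV' starx1'.
Qed.

(** * The bracoid operation of a Hopf-Galois structure *)

Section Grouplikes.
Variables (K : fieldType) (E : splittingFieldType K).
Hypothesis galE : galois 1%AS {:E}.
Variable L : {subfield E}.
Notation G := (gal_of {:E}).
Notation X := (coset_space L).
Notation LK := (subvs_of L).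
Notation e := (cbar L 1%g).

Variable H : hopfGalois LK.

Section Coefficients.
Variable D : X -> 'I_(\dim {:LK}) -> E.
Hypothesis dualD : dual_family (@emb K E L) D.

Let act (h : H) : 'End(LK) := hg_act H h.

Let act_linear t : linear (fun h => act h t).
Proof. exact: hg_act_linear. Qed.

(* End_K(L) is the ring of G-equivariant X * X matrices over E. *)
Definition hg_coef x z (h : H) : E :=
  \sum_k D z k * emb x (act h (vbasis {:LK})`_k).
Notation mc := hg_coef.
Notation co := (mc e).

Lemma hg_coef_linear x z : linear (mc x z).
Proof.
apply: linear_sum_fun => k; apply: linear_mull_fun => a h h'.
by rewrite act_linear emb_linear.
Qed.

Lemma emb_hg_act x h t : emb x (act h t) = \sum_z mc x z h * emb z t.
Proof.
apply: (dualD.2 (fun t => emb x (act h t))) => a s s'.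
by rewrite linearP emb_linear.
Qed.

Lemma hg_coef_unique x h c :
  (forall t, emb x (act h t) = \sum_z c z * emb z t) ->
  forall z, mc x z h = c z.
Proof.
move=> cE; apply: E_independent_eq (emb_independent galE (L := L)) _ => t.
by rewrite -emb_hg_act cE.
Qed.

Lemma hg_coef_translate (g : G) x z h :
  mc (coset_translate g x) (coset_translate g z) h = g (mc x z h).
Proof.
rewrite -{2}[z](coset_translateVK g).
apply: (hg_coef_unique (c := fun z => g (mc x (coset_translate g^-1%g z) h))).
move=> t; rewrite emb_translate emb_hg_act rmorph_sum.
rewrite [RHS](reindex_inj (@coset_translate_inj _ _ _ g)).
by apply: eq_bigr => w _; rewrite coset_translateVK rmorphM /= emb_translate.
Qed.

Lemma hg_coefM x z (h k : H) : mc x z (h * k) = \sum_w mc x w h * mc w z k.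
Proof.
apply: (hg_coef_unique (c := fun z => \sum_w mc x w h * mc w z k)) => t.
rewrite /act hg_actM comp_lfunE emb_hg_act.
under eq_bigr => w _ do rewrite emb_hg_act mulr_sumr.
rewrite exchange_big; apply: eq_bigr => w _.
by rewrite mulr_suml; apply: eq_bigr => v _; rewrite mulrA.
Qed.

Lemma hg_coef1 x z : mc x z (1 : H) = (x == z)%:R.
Proof.
apply: (hg_coef_unique (c := fun z => (x == z)%:R)) => t.
by rewrite sum_delta /act hg_act1 id_lfunE.
Qed.

(** A relation on [co] extends to a linear form [Psi] on End_K(L) that vanishes on every l composed
    with the action of h, hence on all operators because these span. The operators sending t to its
    k-th coordinate give the relations [sumD0], and [D] is invertible. *)
Lemma hg_coef_independent : E_independent co.
Proof.
move=> a a0; pose Psi (f : 'End(LK)) : E :=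
  \sum_y a y * \sum_k D y k * emb e (f (vbasis {:LK})`_k).
have lin_Psi : linear Psi.
  apply: linear_sum_fun => y; apply: linear_mull_fun; apply: linear_sum_fun => k.
  by apply: linear_mull_fun => c f f'; rewrite add_lfunE scale_lfunE emb_linear.
have Psi0 f : Psi f = 0.
  have [g _ gK] := hg_bij H; rewrite -[f]gK (tlift_comp _ _ lin_Psi).
  rewrite /tlift big1 // => i _; set l := _`_i; set h := g f _.
  rewrite -[RHS](mulr0 (emb e l)) -(a0 h) mulr_sumr; apply: eq_bigr => y _.
  rewrite mulrCA; congr (_ * _); rewrite /mc mulr_sumr; apply: eq_bigr => k _.
  by rewrite comp_lfunE lfunE /= embM mulrCA.
have sumD0 k : \sum_y a y * D y k = 0.
  pose f : 'End(LK) := linfun (fun t => coord (vbasis {:LK}) k t *: (1 : LK)).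
  have fE t : f t = coord (vbasis {:LK}) k t *: 1.
    by rewrite linfunE // => c s s'; rewrite linearP scalerDl scalerA.
  rewrite -[RHS](Psi0 f); apply: eq_bigr => y _; congr (_ * _).
  rewrite (bigD1 k) //= big1 ?addr0 => [|j jk].
    rewrite fE coord_free ?(basis_free (vbasisP _)) //.
    by rewrite eqxx scale1r emb1 mulr1.
  rewrite fE coord_free ?(basis_free (vbasisP _)) //.
  by rewrite (negPf jk) scale0r (linear_fun0 (emb_linear _)) mulr0.
move=> z; transitivity (\sum_y (z == y)%:R * a y); first by rewrite sum_delta.
under eq_bigr => y _.
  rewrite eq_sym -(dualD.1 y z) mulr_suml.
  under eq_bigr => k _ do rewrite mulrAC [D _ _ * _]mulrC.
over.
rewrite exchange_big big1 // => k _ /=.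
by rewrite -mulr_suml sumD0 mul0r.
Qed.

(** Expand [emb x] of h(s * t) once by multiplicativity of embeddings and once by the module algebra
    law, then compare coefficients, first as functions of s and then of t. *)
Lemma hg_comul_coef x y z (h : H) :
  tlift (fun a b => mc x y a * mc x z b) (comul H h) = (y == z)%:R * mc x y h.
Proof.
pose T y z := tlift (fun a b => mc x y a * mc x z b) (comul H h).
have ind := emb_independent galE (L := L).
have TE s t : \sum_y (mc x y h * emb y t) * emb y s =
    \sum_y (\sum_z T y z * emb z t) * emb y s.
  transitivity (emb x (act h (s * t))).
    rewrite emb_hg_act; apply: eq_bigr => w _.
    by rewrite embM mulrAC mulrA.
  rewrite /act hg_act_mul (tlift_comp _ _ (emb_linear x)).
  under eq_tlift => a b.
    rewrite embM !emb_hg_act mulr_suml.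
    under eq_bigr => w _.
      rewrite mulr_sumr.
      under eq_bigr => v _ do rewrite mulrACA mulrC.
    over.
  over.
  rewrite tlift_sum; apply: eq_bigr => w _.
  rewrite tlift_sum mulr_suml; apply: eq_bigr => v _.
  by rewrite tlift_mull mulrC -mulrA [emb v t * _]mulrC.
have TE1 t w : mc x w h * emb w t = \sum_z T w z * emb z t.
  by apply: (E_independent_eq ind (TE^~ t)).
rewrite -/(T y z); apply/esym.
apply: (E_independent_eq (a := fun z => (y == z)%:R * mc x y h) ind) => t.
rewrite -TE1; under eq_bigr => w _ do rewrite -mulrA.
by rewrite sum_delta.
Qed.

(** * The group law on the grouplike elements *)

Section Dual.
Variable R : X -> 'I_(\dim {:H}) -> E.
Hypothesis dualR : dual_family co R.

(* The matrix of the grouplike element u_y of E (x) H, which acts on L -> E at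
   the base point e as the embedding y; it is a permutation matrix. *)
Let P y x z := \sum_i R y i * mc x z (vbasis {:H})`_i.

Let coefE x z h : mc x z h = \sum_y P y x z * co y h.
Proof. exact/dualR.2/hg_coef_linear. Qed.

(** Substitute [coefE] into [hg_comul_coef] at (x, z) and (x, w). Comultiplication is diagonal on
    the [co y], so the product of the two entries is the coefficient of [co y]. *)
Let P_orthogonal y x z w : P y x z * P y x w = (z == w)%:R * P y x z.
Proof.
apply: (E_independent_eq (a := fun y => P y x z * P y x w)
  (b := fun y => (z == w)%:R * P y x z) hg_coef_independent) => h.
under [RHS]eq_bigr => v _ do rewrite -mulrA.
rewrite -mulr_sumr -coefE -hg_comul_coef.
under [RHS]eq_tlift => a b.
  rewrite (coefE x z a) (coefE x w b) mulr_suml.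
  under eq_bigr => u _.
    rewrite mulr_sumr.
    under eq_bigr => v _ do rewrite mulrACA.
  over.
over.
rewrite tlift_sum; apply: eq_bigr => u _; rewrite tlift_sum.
under eq_bigr => v _ do rewrite tlift_mull hg_comul_coef mulrCA.
by rewrite sum_delta.
Qed.

Let sum_coef x h : \sum_z mc x z h = (counit H h : K)%:A.
Proof.
transitivity (emb x (act h 1)).
  by rewrite emb_hg_act; apply: eq_bigr => z _; rewrite emb1 mulr1.
by rewrite /act hg_act_unit (linear_funZ (emb_linear x)) emb1.
Qed.

Let P_sum y x : \sum_z P y x z = 1.
Proof.
apply: (E_independent_eq (a := fun y => \sum_z P y x z) (b := fun=> 1)
  hg_coef_independent) => h.
under eq_bigr => z _ do rewrite mulr_suml.
rewrite exchange_big; under eq_bigr => z _ do rewrite -coefE.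
by under [RHS]eq_bigr => z _ do rewrite mul1r; rewrite !sum_coef.
Qed.

(** Row x of the matrix of u_y consists of orthogonal idempotents of the field E with sum 1, so
    exactly one entry is nonzero and the default is never taken. *)
Definition hg_star y x : X := odflt e [pick z | P y x z != 0].
Notation star := hg_star.

Let PE y x z : P y x z = (star y x == z)%:R.
Proof.
rewrite /star; case: pickP => /= [w Pw|P0]; last first.
  move/eqP: (P_sum y x); rewrite big1 => [|w _]; last by apply/eqP/negbFE/P0.
  by rewrite eq_sym oner_eq0.
have Pw1 : P y x w * P y x w = P y x w * 1.
  by rewrite P_orthogonal eqxx mul1r mulr1.
have := P_orthogonal y x w z; case: eqP => [<- _|_]; first exact: (mulfI Pw Pw1).
by rewrite mul0r => /eqP; rewrite mulf_eq0 (negPf Pw) => /eqP.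
Qed.

Lemma hg_coef_star x z h : mc x z h = \sum_y (star y x == z)%:R * co y h.
Proof. by rewrite coefE; apply: eq_bigr => y _; rewrite PE. Qed.

Let star_e y : star y e = y.
Proof.
apply/eqP; have := PE y e y; rewrite /P (dualR.1 y y) eqxx.
by case: eqP => // _ /eqP; rewrite oner_eq0.
Qed.

Let e_star x : star e x = x.
Proof.
have := hg_coef_star x x 1; rewrite hg_coef1 eqxx.
under eq_bigr => y _ do rewrite hg_coef1 mulrC.
rewrite sum_delta; case: eqP => // _ /eqP; by rewrite oner_eq0.
Qed.

Let natr_eq (a b : bool) : a%:R = b%:R :> E -> a = b.
Proof.
by case: a b => [] [] // /eqP; rewrite ?oner_eq0 // eq_sym oner_eq0.
Qed.

(** Expand [mc x z (h * k)] in two ways: through the coefficients of h * k at e, and as a matrix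
    product. Independence of [co], used for k and then for h, isolates v and w; the index from k
    stands on the left because operators compose in the order opposite to [star]. *)
Let starA v w x : star (star v w) x = star v (star w x).
Proof.
have coM y h k : co y (h * k) =
    \sum_w \sum_v (star v w == y)%:R * co v k * co w h.
  rewrite hg_coefM; apply: eq_bigr => u _.
  by rewrite (hg_coef_star u y) mulrC mulr_suml.
pose z := star v (star w x).
suff /natr_eq : (star (star v w) x == z)%:R = (star v (star w x) == z)%:R :> E.
  by rewrite eqxx => /eqP.
have ind := hg_coef_independent.
apply: (E_independent_eq (a := fun v => (star (star v w) x == z)%:R)
  (b := fun v => (star v (star w x) == z)%:R) ind) => k.
apply: (E_independent_eq
  (a := fun w => \sum_v (star (star v w) x == z)%:R * co v k)
  (b := fun w => \sum_v (star v (star w x) == z)%:R * co v k) ind) => h.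
transitivity (mc x z (h * k)).
  rewrite (hg_coef_star x z); under [RHS]eq_bigr => y _ do rewrite coM mulr_sumr.
  rewrite exchange_big; apply: eq_bigr => u _ /=.
  under [RHS]eq_bigr => y _ do rewrite mulr_sumr.
  rewrite exchange_big mulr_suml; apply: eq_bigr => u' _ /=.
  under [RHS]eq_bigr => y _ do rewrite -mulrA mulrCA.
  by rewrite sum_delta mulrA.
rewrite hg_coefM; under eq_bigr => q _ do rewrite !hg_coef_star mulr_suml.
rewrite exchange_big; apply: eq_bigr => u _ /=.
under eq_bigr => q _ do rewrite -mulrA.
by rewrite sum_delta mulrC.
Qed.

(** Let [s] be the matrix of the antipode on the grouplikes. The coefficient at e of the antipode
    identity says that the entries [s w v] with star v w = e sum to 1, so there is such a w. *)
Let star_inverse v : exists w, star v w == e.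
Proof.
pose s w u := \sum_i R u i * co w (antipode H (vbasis {:H})`_i).
have sE w h : co w (antipode H h) = \sum_u s w u * co u h.
  apply: (dualR.2 (fun h => co w (antipode H h))) => a b b'.
  by rewrite linearP hg_coef_linear.
have sum_s : \sum_w s w v * (star v w == e)%:R = 1.
  apply: (E_independent_eq (a := fun v => \sum_w s w v * (star v w == e)%:R)
    (b := fun=> 1) hg_coef_independent) => h.
  transitivity (co e ((counit H h : K)%:A : H)).
    rewrite -antipodel (tlift_comp _ _ (hg_coef_linear e e)).
    under [RHS]eq_tlift => a b.
      rewrite hg_coefM.
      under eq_bigr => w _.
        rewrite (hg_coef_star w e b) sE mulr_suml.
        under eq_bigr => u _.
          rewrite mulr_sumr.
          under eq_bigr => u' _ do rewrite mulrACA.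
        over.
      over.
    over.
    rewrite tlift_sum; under eq_bigr => u _ do rewrite mulr_suml.
    rewrite exchange_big; apply: eq_bigr => w _ /=; rewrite tlift_sum.
    apply: eq_bigr => u _; rewrite tlift_sum.
    under [RHS]eq_bigr => u' _ do rewrite tlift_mull hg_comul_coef mulrCA.
    by rewrite sum_delta.
  rewrite (linear_funZ (hg_coef_linear e e)) hg_coef1 eqxx.
  by under [RHS]eq_bigr => w _ do rewrite mul1r; rewrite sum_coef.
apply/existsP; apply: contraT => /existsPn no_inv.
move/eqP: sum_s; rewrite big1 => [|w _]; last by rewrite (negPf (no_inv w)) mulr0.
by rewrite eq_sym oner_eq0.
Qed.

Notation inv := (star_inv e star).

Let starxV v : star v (inv v) = e.
Proof.
rewrite star_inv.unlock; case: pickP => [w /eqP //|none].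
by have [w] := star_inverse v; rewrite none.
Qed.

Let starVx v : star (inv v) v = e.
Proof.
have vE : inv (inv v) = v.
  by rewrite -[LHS]e_star -{1}(starxV v) starA starxV star_e.
by rewrite -[X in star _ X]vE starxV.
Qed.

Let starK x : cancel (star^~ x) (star^~ (inv x)).
Proof. by move=> y; rewrite /= starA starxV star_e. Qed.

Let starVK x : cancel (star^~ (inv x)) (star^~ x).
Proof. by move=> y; rewrite /= starA starVx star_e. Qed.

Let coef_co x z h : mc x z h = co (star z (inv x)) h.
Proof.
rewrite hg_coef_star.
transitivity (\sum_y (star z (inv x) == y)%:R * co y h); last exact: sum_delta.
apply: eq_bigr => y _.
have -> : (star y x == z) = (star z (inv x) == y); last by [].
by apply/eqP/eqP => <-; rewrite ?starK ?starVK.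
Qed.

Lemma hg_based_bracoid : based_bracoid star.
Proof.
split; first by split=> [x y z|||//|//]; rewrite ?starA.
move=> g x y.
(* Both sides index the same function: by [coef_co] they give the matrix entries at (g e, g x) and
   (g y, g (star x y)), and both of these equal g (co x h). *)
suff eqt : star (coset_translate g x) (inv (coset_translate g e)) =
    star (coset_translate g (star x y)) (inv (coset_translate g y)).
  by rewrite eqt (starVK (coset_translate g y)).
apply: (E_independent_inj hg_coef_independent) => h.
have coL := coef_co (coset_translate g e) (coset_translate g x) h.
have coR := coef_co (coset_translate g y) (coset_translate g (star x y)) h.
apply: (etrans (esym coL)); apply: (etrans _ coR).
rewrite !hg_coef_translate (coef_co y (star x y)); congr (g _).
by rewrite (starK y x).
Qed.

Lemma hg_act_operator h : star_operator star (act h).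
Proof.
exists (co^~ h); split=> [g y|t]; last by rewrite -emb_base emb_hg_act.
by apply: (etrans (esym (hg_coef_translate g e y h))); apply: coef_co.
Qed.

End Dual.
End Coefficients.

Lemma hg_limg_star : exists star, @based_bracoid K E L star /\
  forall f, f \in limg (hg_act H) <-> star_operator star f.
Proof.
have [D dualD] : exists D, dual_family (@emb K E L) D.
  apply: dual_family_exists; first exact: emb_linear.
    exact: emb_independent.
  exact: card_coset_space.
have [R dualR] : exists R, dual_family (hg_coef D e) R.
  apply: dual_family_exists; first exact: hg_coef_linear.
    exact: hg_coef_independent.
  by rewrite card_coset_space // hg_dim.
have B := hg_based_bracoid dualD dualR.
exists (hg_star D R); split=> // f.
(* Only one inclusion has been shown. The structure built from [star] has all star operators as its
   image, and both images have dimension [L:K]. *)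
have [H1 H1E] := star_hopf_galois_exists galE B.
suff -> : limg (hg_act H) = limg (hg_act H1) by [].
have dim_limg (H2 : hopfGalois LK) : \dim (limg (hg_act H2)) = \dim {:LK}.
  rewrite limg_dim_eq ?hg_dim //; apply/eqP; rewrite capfv.
  exact/lker0P/hg_act_inj.
apply/eqP; rewrite eqEdim !dim_limg leqnn andbT.
apply/subvP => _ /memv_imgP[h _ ->]; apply/H1E.
exact: hg_act_operator.
Qed.

End Grouplikes.

(** * Stable regular subgroups and the correspondence *)

Lemma injective_surjective_bijective (A B : Type) (f : A -> B) :
  injective f -> (forall b, exists a, f a = b) -> bijective f.
Proof.
move=> f_inj f_surj.
pose g b := proj1_sig (constructive_indefinite_description _ (f_surj b)).
have gK b : f (g b) = b by rewrite /g; case: constructive_indefinite_description.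
by exists g => // a; apply: f_inj; rewrite gK.
Qed.

Lemma sig_eq (A : Type) (P : A -> Prop) (u v : {a | P a}) :
  proj1_sig u = proj1_sig v -> u = v.
Proof. by apply: eq_sig_hprop => x; apply: proof_irrelevance. Qed.

Section Subgroups.
Variables (K : fieldType) (E : splittingFieldType K) (L : {subfield E}).
Notation G := (gal_of {:E}).
Notation X := (coset_space L).
Notation e := (cbar L 1%g).
Implicit Type star : X -> X -> X.

Lemma based_bracoidE star :
  skew_bracoid (@gal_comp K E) star (@coset_translate K E L)
    /\ left_id e star /\ right_id e star <-> based_bracoid star.
Proof.
split=> [[[eG [invG [eN [invN [_ starG _ _ law]]]]] [star1x starx1]]|[starG law]].
  have eNe : eN = e by case: starG => _ star1x' _ _ _; rewrite -[RHS]star1x' starx1.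
  by rewrite eNe in starG law; apply: based_bracoidI starG law.
have [_ star1x starx1 _ _] := starG; split; last by [].
exists 1%g, (fun g : G => g^-1%g), e, (star_inv e star); split=> //.
- split=> [x y z|x|x|x|x]; rewrite /gal_comp.
  + by rewrite mulgA.
  + by rewrite mulg1.
  + by rewrite mul1g.
  + by rewrite mulgV.
  + by rewrite mulVg.
- by split=> [x|g h x]; rewrite ?coset_translate1 ?coset_translateM.
- by move=> x y; apply: coset_translate_trans.
Qed.

(* The permutations commuting with right translations: for a group operation,
   the left translations. *)
Definition left_translations star : {set {perm X}} :=
  [set n : {perm X} | [forall x, forall y, n (star x y) == star (n x) y]].

Lemma left_translationsP star (n : {perm X}) :
  reflect (forall x y, n (star x y) = star (n x) y) (n \in left_translations star).
Proof.
rewrite inE; apply: (iffP forallP) => [n_star x y|n_star x].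
  by move/forallP: (n_star x) => /(_ y)/eqP.
by apply/forallP => y; rewrite n_star.
Qed.

Lemma left_translations_group_set star : group_set (left_translations star).
Proof.
apply/group_setP; split=> [|n m /left_translationsP nP /left_translationsP mP].
  by apply/left_translationsP => x y; rewrite !perm1.
by apply/left_translationsP => x y; rewrite !permM nP mP.
Qed.

Canonical left_translations_group star := group (left_translations_group_set star).

Section Bracoid.
Variable star : X -> X -> X.
Hypothesis bracoid : based_bracoid star.
Notation inv := (star_inv e star).
Notation N := (left_translations star).

Let starA : associative star. Proof. by case: bracoid => [[]]. Qed.
Let star1x : left_id e star. Proof. by case: bracoid => [[]]. Qed.
Let starx1 : right_id e star. Proof. by case: bracoid => [[]]. Qed.
Let starVx : left_inverse e inv star. Proof. by case: bracoid => [[]]. Qed.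
Let starxV : right_inverse e inv star. Proof. by case: bracoid => [[]]. Qed.

Lemma left_translationE n x : n \in N -> n x = star (n e) x.
Proof. by move/left_translationsP => n_star; rewrite -n_star star1x. Qed.

Lemma star_left_inj x : injective (star x).
Proof.
by apply: (@can_inj _ _ _ (star (inv x))) => y; rewrite starA starVx star1x.
Qed.

Lemma left_translation_in x : perm (@star_left_inj x) \in N.
Proof. by apply/left_translationsP => y z; rewrite !permE starA. Qed.

(** Conjugating the left translation by n e gives the one by gamma g (n e). Inclusion is enough,
    since a conjugate has the same cardinality. *)
Lemma left_translations_stable : G_stable (left_translations_group star).
Proof.
move=> g; apply/eqP; rewrite eqEcard cardJg leqnn andbT.
apply/subsetP => _ /imsetP[n nN ->].
have nE z : (n ^ lambda_odot L g)%g z = star (star_conj star g (n e)) z.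
  rewrite -{1}(coset_translateKV g z) -(permE (@coset_translate_inj _ _ _ g)).
  rewrite permJ permE (left_translationE _ nN) (translate_conj bracoid).
  by rewrite coset_translateKV.
by apply/left_translationsP => x y; rewrite !nE starA.
Qed.

Lemma left_translations_regular : regular (left_translations_group star).
Proof.
split.
  apply/imsetP; exists e; rewrite ?inE //; apply/setP => x; rewrite inE.
  apply/esym/orbitP; exists (perm (@star_left_inj x)).
    exact: left_translation_in.
  by rewrite /= /aperm permE starx1.
move=> x; apply/trivgP/subsetP => n /setIP[nN /astab1P]; rewrite /= /aperm => nx.
apply/set1P/permP => z; rewrite perm1.
have /left_translationsP n_star := nN.
by rewrite -[z]star1x -(starxV x) -starA n_star nx.
Qed.

End Bracoid.

Lemma left_translations_inj star star' :
  based_bracoid star -> based_bracoid star' ->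
  left_translations star = left_translations star' ->
  forall x y, star x y = star' x y.
Proof.
move=> B B' eqN x y; have := left_translation_in B x; rewrite eqN.
move/(left_translationE B' y); rewrite !permE => ->.
by have [[_ _ -> _ _] _] := B.
Qed.

Section Regular.
Variable N : {group {perm X}}.
Hypotheses (stable : G_stable N) (regN : regular N).

Let translation_exists x : exists n, (n \in N) && (n e == x).
Proof.
have [transN _] := regN; have /atransP2 := transN.
move=> /(_ e x)[]; rewrite ?inE // => n nN xE.
by exists n; rewrite nN xE eqxx.
Qed.

Let nu x := xchoose (translation_exists x).

Let nuN x : nu x \in N.
Proof. by have /andP[] := xchooseP (translation_exists x). Qed.

Let nu_e x : nu x e = x.
Proof. by have /andP[_ /eqP] := xchooseP (translation_exists x). Qed.

Let nu_unique n : n \in N -> n = nu (n e).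
Proof.
move=> nN; have [_ /(_ e) stab1] := regN.
apply/esym/eqP; rewrite eq_mulgV1 -in_set1 -[[set _]]stab1 inE groupM ?groupV //=.
by apply/astab1P; rewrite /= /aperm permM nu_e permK.
Qed.

Let nuM n x : n \in N -> (nu x * n)%g = nu (n x).
Proof.
move=> nN; have xnN := groupM (nuN x) nN.
by rewrite (nu_unique xnN) (permM (nu x) n e) nu_e.
Qed.

Definition regular_star x y : X := nu x y.
Notation star := regular_star.

Lemma regular_star_bracoid : based_bracoid star.
Proof.
have starA : associative star.
  by move=> x y z; rewrite /star -(nuM y (nuN x)) permM.
have star1x : left_id e star.
  by move=> x; rewrite /star -[e](perm1 e) -(nu_unique (group1 N)) perm1.
pose inv x := ((nu x)^-1)%g e.
have starVx : left_inverse e inv star.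
  move=> x; rewrite /star /inv -nu_unique ?groupV //.
  by rewrite -{2}(nu_e x) permK.
have starxV : right_inverse e inv star.
  by move=> x; rewrite /star /inv permKV.
apply: (@based_bracoidI _ _ _ _ inv) => // g x y.
(* By stability m lies in N, so it is left translation by m e. It sends g y to g (star x y) and g e
   to g x; hence m e is g x times the inverse of g e, which is the bracoid law. *)
pose m := (nu x ^ lambda_odot L g)%g.
have mN : m \in N by rewrite -(stable g) memJ_conjg.
have mE z : m (coset_translate g z) = coset_translate g (nu x z).
  by rewrite -!(permE (@coset_translate_inj _ _ _ g)) permJ.
have mstar z : m z = star (m e) z by rewrite /star -(nu_unique mN).
rewrite -mE mstar.
have <- : star (m e) (coset_translate g e) = coset_translate g x.
  by rewrite -mstar mE nu_e.
by rewrite -(starA (m e)) starxV [star _ e]nu_e.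
Qed.

Lemma regular_star_translations : left_translations star = N.
Proof.
apply/setP => n; apply/left_translationsP/idP => [n_star|nN x y].
  suff -> : n = nu (n e) by apply: nuN.
  apply/permP => y; have [[_ star1x _ _ _] _] := regular_star_bracoid.
  by rewrite -[y in LHS]star1x n_star.
by rewrite /star -(nuM x nN) permM.
Qed.

End Regular.
End Subgroups.

(** * The bijections *)

Section Correspondence.
Variables (K : fieldType) (E : splittingFieldType K).
Hypothesis galE : galois 1%AS {:E}.
Variable L : {subfield E}.

Lemma operations_based (s : bracoid_operations L) : based_bracoid (proj1_sig s).
Proof. by case: s => star /= /based_bracoidE. Qed.

Definition subgroup_of_operation (s : bracoid_operations L) :
    stable_regular_subgroups L :=
  exist _ (left_translations_group (proj1_sig s))
    (conj (left_translations_stable (operations_based s))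
          (left_translations_regular (operations_based s))).

Lemma subgroup_of_operation_bij : bijective subgroup_of_operation.
Proof.
apply: injective_surjective_bijective => [s s' eqN|[N [stable regN]]].
  apply: sig_eq; apply: functional_extensionality => x.
  apply: functional_extensionality => y.
  apply: left_translations_inj (operations_based s) (operations_based s') _ x y.
  exact: (congr1 (fun M => gval (proj1_sig M)) eqN).
have B := regular_star_bracoid stable regN.
exists (exist _ (regular_star regN) (iffRL (based_bracoidE _) B)).
by apply/sig_eq/val_inj => /=; apply: regular_star_translations.
Qed.

(** By [hg_isoE] an isomorphism class is the set of structures with a given image in End_K(L), so
    the class is named without choosing a Hopf algebra in it. *)
Definition hg_class_of (star : coset_space L -> coset_space L -> coset_space L)
    (H : hopfGalois (subvs_of L)) : Prop :=
  forall f, f \in limg (hg_act H) <-> star_operator star f.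

Lemma hg_class_of_iso star (H : hopfGalois (subvs_of L)) :
  hg_class_of star H -> hg_class_of star = hg_iso H.
Proof.
move=> HE; apply: functional_extensionality => H1.
apply: propositional_extensionality; rewrite hg_isoE.
split=> [H1E|eqH f]; last by rewrite -eqH; apply: HE.
by apply/vspaceP => f; apply/idP/idP => [/HE/H1E|/H1E/HE].
Qed.

Lemma hg_class_of_exists (s : bracoid_operations L) :
  exists H, hg_class_of (proj1_sig s) = hg_iso H.
Proof.
have [H HE] := star_hopf_galois_exists galE (operations_based s).
by exists H; apply: hg_class_of_iso.
Qed.

Definition structure_of_operation (s : bracoid_operations L) :
    hopf_galois_structures (subvs_of L) :=
  exist _ (hg_class_of (proj1_sig s)) (hg_class_of_exists s).

Lemma structure_of_operation_bij : bijective structure_of_operation.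
Proof.
apply: injective_surjective_bijective => [s s' eqC|[C [H CE]]].
  apply: sig_eq; apply: functional_extensionality => x.
  apply: functional_extensionality => y.
  apply: (star_operator_inj galE (operations_based s) (operations_based s')) => f.
  have [H HE] := star_hopf_galois_exists galE (operations_based s).
  have : hg_class_of (proj1_sig s') H.
    by rewrite -(congr1 (@proj1_sig _ _) eqC : hg_class_of _ = hg_class_of _).
  by move=> HE' /HE/HE'.
have [star [B HE]] := hg_limg_star galE H.
exists (exist _ star (iffRL (based_bracoidE _) B)).
by apply: sig_eq; rewrite /= CE; apply: hg_class_of_iso.
Qed.

End Correspondence.

Theorem theorem5p1 (K : fieldType) (E : splittingFieldType K)
    (galE : galois 1%AS {:E}) (L : {subfield E}) :
  (exists f : bracoid_operations L -> stable_regular_subgroups L,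
     bijective f) /\
  (exists f : stable_regular_subgroups L ->
              hopf_galois_structures (subvs_of L), bijective f).
Proof.
have bijN := @subgroup_of_operation_bij K E L.
split; first by exists (@subgroup_of_operation K E L).
have [g gK fK] := bijN.
exists (@structure_of_operation K E galE L \o g).
apply: bij_comp (structure_of_operation_bij galE L) _.
by exists (@subgroup_of_operation K E L).
Qed.
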